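(* Let $H$ be a Hilbert space. Sending a structure $\mu$ of commutative Hilbertian Frobenius semigroup on $H$ to its set $G(H,\mu)$ of group-like elements provides one-one correspondences between: (1) structures of commutative Hilbertian Frobenius semigroups on $H$ with a non-zero multiplication, and non-void bounded above orthogonal sets of $H$; (2) structures of semisimple commutative Hilbertian Frobenius semigroups on $H$, and bounded above orthogonal bases of $H$; (3) structures of commutative Hilbertian Frobenius semigroups on $H$ whose comultiplication $\mu^{\dagger}$ is a non-zero partial isometry, and non-void orthonormal sets of $H$; (4) structures of commutative special Hilbertian Frobenius semigroups on $H$, and orthonormal bases of $H$; moreover the corresponding semigroups are all unitarily isomorphic; (5) the empty orthogonal set corresponds to the unique structure of radical Frobenius semigroup on $H$.
   Context: All Hilbert spaces are complex; $\hat{\otimes}_2$ is the Hilbert space tensor product; $f^{\dagger}$ is the Hilbert adjoint of a bounded linear map $f$. A Hilbertian algebra (or Hilbertian semigroup) is a pair $(H,\mu)$ with $H$ a Hilbert space and $\mu\colon H\hat{\otimes}_2H\to H$ a bounded linear map which is associative and commutative (no unit is assumed); write $xy:=\mu(x\otimes y)$. With $\alpha\colon (H\hat{\otimes}_2H)\hat{\otimes}_2H\to H\hat{\otimes}_2(H\hat{\otimes}_2H)$ the canonical unitary, $(H,\mu)$ is a (commutative) Hilbertian Frobenius semigroup when moreover $(\mu\hat{\otimes}_2 id)\circ\alpha^{-1}\circ(id\hat{\otimes}_2\mu^{\dagger})=\mu^{\dagger}\circ\mu=(id\hat{\otimes}_2\mu)\circ\alpha\circ(\mu^{\dagger}\hat{\otimes}_2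 id)$. It is special when $\mu\circ\mu^{\dagger}=id_H$. A structure of Hilbertian semigroup of some kind on $H$ is a bounded linear map $\mu\colon H\hat{\otimes}_2H\to H$ such that $(H,\mu)$ is a Hilbertian semigroup of that kind. Two Hilbertian semigroups are unitarily isomorphic when there is a unitary map between them preserving the products. $G(H,\mu):=\{x\in H\setminus\{0\}\colon\mu^{\dagger}(x)=x\otimes x\}$. The Jacobson radical $J(H,\mu)$ is that of the commutative Banach algebra $H$ with product $(x,y)\mapsto xy$ (and an equivalent submultiplicative norm), i.e. the intersection of its maximal modular ideals, equivalently of the kernels of its non-zero algebra maps to $\mathbb{C}$. $(H,\mu)$ is semisimple when $J(H,\mu)=(0)$ and radical when $J(H,\mu)=H$. An orthogonal set is a set of pairwise orthogonal non-zero vectors ($\emptyset$ is an orthogonal, and orthonormal, set); an orthogonal basis is an orthogonal set $X$ with $X^{\perp}=0$. A subset $X\subseteq H$ is bounded above if there is $C>0$ with $\|x\|\leq C$ for all $x\in X$. A bounded linear map $f$ between Hilbert spaces is a partial isometry if $f\circ f^{\dagger}\circ f=f$. *)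

(* Defs.v *)
Set Warnings "-notation-overridden,-ambiguous-paths,-notation-incompatible-prefix".
From HB Require Import structures.
From mathcomp Require Import all_boot all_order all_algebra.
From mathcomp Require Import sesquilinear complex.
From mathcomp Require Import all_classical all_reals all_analysis.

Set Implicit Arguments.
Unset Strict Implicit.
Unset Printing Implicit Defensive.

Import Order.TTheory GRing.Theory Num.Theory.
Import numFieldNormedType.Exports.

Local Open Scope classical_set_scope.
Local Open Scope ring_scope.
Local Open Scope complex_scope.

(* Complex Hilbert spaces.  [inner] is linear in its first argument and
   antilinear in its second one.  The norm of a normed module over [R[i]] takes
   its values in (the nonnegative reals of) [R[i]]. *)
HB.mixin Record CompleteNormedModule_isHilbert (R : realType) (V : Type)
    & CompleteNormedModule R[i] V := {
  inner : {dot V for (@Num.conj R[i])};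
  inner_normE : forall x : V, inner x x = `|x| ^+ 2
}.

#[short(type="hilbertType")]
HB.structure Definition Hilbert (R : realType) :=
  {V of CompleteNormedModule R[i] V & CompleteNormedModule_isHilbert R V}.

Section BoundedOperators.
Context {R : realType}.
Implicit Types V W : hilbertType R.

Definition bounded_linear V W (f : V -> W) :=
  linear f /\ exists M : R, forall x, `|f x| <= M%:C * `|x|.

(* For [f] bounded linear, the set below is a singleton by the Riesz
   representation theorem. *)
Definition adjoint V W (f : V -> W) : W -> V :=
  fun y => get [set z | forall x, inner (f x) y = inner x z].

Definition partial_isometry V W (f : V -> W) :=
  bounded_linear f /\ f \o adjoint f \o f = f.

Definition unitary V W (f : V -> W) :=
  [/\ bounded_linear f, adjoint f \o f = id & f \o adjoint f = id].

End BoundedOperators.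

(* A Hilbert tensor product of [V] and [W]: a Hilbert completion of the
   algebraic tensor product for the inner product determined by [tensorE].
   It is unique up to a unique unitary map compatible with [tensor]. *)
Record hilbertTensor (R : realType) (V W : hilbertType R) := HilbertTensor {
  tensor_space :> hilbertType R;
  tensor : {bilinear V -> W -> tensor_space};
  tensorE : forall x y x' y',
    inner (tensor x y) (tensor x' y') = inner x x' * inner y y';
  tensor_dense : dense [set t | exists n (x : 'I_n -> V) (y : 'I_n -> W),
    t = \sum_(i < n) tensor (x i) (y i)]
}.

Section TensorOperators.
Context {R : realType}.

(* In the two definitions below the set is a singleton (for [f] and [g] bounded
   linear in the first one). *)
Definition tensor_map (V W V' W' : hilbertType R)
    (VW : hilbertTensor V W) (VW' : hilbertTensor V' W')
    (f : V -> V') (g : W -> W') : VW -> VW' :=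
  get [set h : VW -> VW' | bounded_linear h /\
    forall x y, h (tensor VW x y) = tensor VW' (f x) (g y)].

Definition associator (U V W : hilbertType R)
    (UV : hilbertTensor U V) (VW : hilbertTensor V W)
    (UVl : hilbertTensor UV W) (UVr : hilbertTensor U VW) : UVl -> UVr :=
  get [set h : UVl -> UVr | bounded_linear h /\
    forall x y z, h (tensor UVl (tensor UV x y) z) =
                  tensor UVr x (tensor VW y z)].

End TensorOperators.

Arguments tensor_map {R V W V' W'} VW VW' f g.
Arguments associator {R U V W UV VW} UVl UVr.

Section HilbertianSemigroups.
Context {R : realType} {H : hilbertType R} {HH : hilbertTensor H H}.
Implicit Type mu : HH -> H.

Definition mul mu (x y : H) : H := mu (tensor HH x y).

Definition hilbertian_algebra mu :=
  [/\ bounded_linear mu, associative (mul mu) & commutative (mul mu)].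

Definition group_like mu : set H :=
  [set x | x <> 0 /\ adjoint mu x = tensor HH x x].

Definition frobenius (HHl : hilbertTensor HH H) (HHr : hilbertTensor H HH) mu :=
  let alpha := associator HHl HHr in
  [/\ hilbertian_algebra mu,
      tensor_map HHl HH mu id \o pinv [set: HHl] alpha
        \o tensor_map HH HHr id (adjoint mu) = adjoint mu \o mu &
      adjoint mu \o mu = tensor_map HHr HH id mu \o alpha
        \o tensor_map HH HHl (adjoint mu) id].

Definition special mu := mu \o adjoint mu = id.

Definition ideal mu (I : set H) :=
  [/\ I 0, forall (a : R[i]) x y, I x -> I y -> I (a *: x + y) &
      forall x y, I y -> I (mul mu x y)].

Definition modular mu (I : set H) := exists u, forall x, I (x - mul mu u x).

Definition maximal_modular mu (I : set H) :=
  [/\ ideal mu I, modular mu I, I <> setT &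
      forall J, ideal mu J -> I `<=` J -> J = I \/ J = setT].

Definition jacobson_radical mu : set H :=
  \bigcap_(I in [set I | maximal_modular mu I]) I.

Definition semisimple mu := jacobson_radical mu = [set 0].

Definition radical mu := jacobson_radical mu = setT.

End HilbertianSemigroups.

Definition unitarily_isomorphic (R : realType) (H H' : hilbertType R)
    (HH : hilbertTensor H H) (HH' : hilbertTensor H' H')
    (mu : HH -> H) (mu' : HH' -> H') :=
  exists u : H -> H', unitary u /\
    forall x y, u (mul mu x y) = mul mu' (u x) (u y).

Section OrthogonalSets.
Context {R : realType} {H : hilbertType R}.
Implicit Type X : set H.

Definition orthogonal_set X :=
  (forall x, X x -> x <> 0) /\
  (forall x y, X x -> X y -> x <> y -> inner x y = 0).

Definition orthonormal_set X :=
  orthogonal_set X /\ forall x, X x -> `|x| = 1.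

Definition total_set X :=
  [set y | forall x, X x -> inner x y = 0] = [set 0].

Definition orthogonal_basis X := orthogonal_set X /\ total_set X.

Definition orthonormal_basis X := orthonormal_set X /\ total_set X.

Definition bounded_above X :=
  exists C : R, 0 < C /\ forall x, X x -> `|x| <= C%:C.

End OrthogonalSets.

(* Main.v *)
Require Import Defs.
From HB Require Import structures.
From mathcomp Require Import all_boot all_order all_algebra.
From mathcomp Require Import finmap sesquilinear complex.
From mathcomp Require Import all_classical all_reals all_analysis.
From mathcomp Require Import ring lra.

Set Implicit Arguments.
Unset Strict Implicit.
Unset Printing Implicit Defensive.

Import Order.TTheory GRing.Theory Num.Theory.
Import numFieldNormedType.Exports.

Local Open Scope classical_set_scope.
Local Open Scope ring_scope.
Local Open Scope complex_scope.

(** Write [Delta] for the adjoint of [mu] and [L_x] for the operator that sends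
    [y] to [xy].

    Pairing with elementary tensors turns everything into statements about the
    product.  A vector [g <> 0] is group-like exactly when
    [<xy, g> = <x, g><y, g>], that is when it represents a character
    ([group_likeE]), and the Frobenius condition says that the adjoint of [L_x]
    is a module map ([frobenius_mul_of]).  Hence the [L_x] are commuting normal
    operators, a character is a joint eigenvector, [xg = <x, g> g], and computing
    [gh] in two ways shows that distinct characters are orthogonal.  From
    [gg = |g|^2 g] they are bounded in norm.

    The heart of the matter is that a product vanishes when one factor is
    orthogonal to all characters ([mul_annihilator]).  Let [K] be the ideal of
    these vectors and suppose that [z] in [K] has [L_z <> 0].  With [a] the image
    of [z] under the adjoint of [L_z], the operator [L_a] is the product of [L_z]
    and its adjoint, hence positive, and after rescaling [z] it has norm 1.  The
    powers of [a] then converge to an idempotent [p <> 0] of [K] with [L_p]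
    self-adjoint ([projection_normalised]).  Squared norms are additive over
    orthogonal idempotents of this kind and bounded below, so [p] can be chosen
    primitive.  Below a primitive [p] the same construction only gives [p] back,
    which forces [pH] to be the line spanned by [p]; then [p / |p|^2] is a
    character ([character_exists]).  Lying in [K] it is orthogonal to itself,
    which is absurd.  No spectral theory enters.  By normality all products are
    moreover orthogonal to [K], so the characters determine the product
    ([frobenius_mul_unique]).

    Conversely a bounded orthogonal set [X] defines a bounded [Delta], with
    [Delta g = g (x) g] on [X] and [Delta = 0] on the orthogonal complement of
    [X]; its adjoint is a Frobenius structure whose group-like elements are
    exactly the members of [X] ([frobenius_exists]).  So [group_like] is a
    bijection from all structures onto all bounded orthogonal sets, and each item
    of the theorem is the restriction of this bijection to a property that can be
    read off on [G]: the Jacobson radical is the orthogonal complement of [G]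
    ([jacobson_radicalE]), and [mu (Delta g) = |g|^2 g] decides whether [mu] is
    special or [Delta] a partial isometry.

    Two special structures are intertwined by the unitary that matches their
    orthonormal bases of group-like elements, once these bases are known to be
    equipotent ([orthonormal_bases_equipotent]).

    The operators involved come from completeness in the form of the closest
    point theorem: it yields adjoints through Riesz representation, and density
    of the span of a total family, whence [bounded_extension], which produces
    the operators on tensor products, the associator, [Delta] and the unitary. *)

(** * Norms with real values *)

Section RealNorm.
Context {R : realType}.

(** The norm takes its values in [R[i]], where the order is only partial. *)
Definition rnorm (V : normedModType R[i]) (x : V) : R := complex.Re `|x|.

Lemma rnormE (V : normedModType R[i]) (x : V) : `|x| = (rnorm x)%:C.
Proof. by rewrite /rnorm RRe_real// ger0_real. Qed.

Lemma rnorm_ge0 (V : normedModType R[i]) (x : V) : 0 <= rnorm x.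
Proof. by rewrite -ler0c -rnormE. Qed.

Lemma rnorm0 (V : normedModType R[i]) : rnorm (0 : V) = 0.
Proof. by rewrite /rnorm normr0. Qed.

Lemma rnorm_eq0 (V : normedModType R[i]) (x : V) : rnorm x = 0 -> x = 0.
Proof. by move=> x0; apply/eqP; rewrite -normr_eq0 rnormE x0. Qed.

Lemma rnorm_gt0 (V : normedModType R[i]) (x : V) : x <> 0 -> 0 < rnorm x.
Proof.
by move=> x0; rewrite lt_neqAle rnorm_ge0 andbT eq_sym; apply/eqP => /rnorm_eq0.
Qed.

Lemma ler_rnormD (V : normedModType R[i]) (x y : V) :
  rnorm (x + y) <= rnorm x + rnorm y.
Proof. by rewrite -lecR rmorphD/= -!rnormE ler_normD. Qed.

Lemma rnormN (V : normedModType R[i]) (x : V) : rnorm (- x) = rnorm x.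
Proof. by rewrite /rnorm normrN. Qed.

Lemma rnormBC (V : normedModType R[i]) (x y : V) : rnorm (x - y) = rnorm (y - x).
Proof. by rewrite /rnorm distrC. Qed.

Lemma rnormZ (V : normedModType R[i]) (a : R[i]) (x : V) :
  rnorm (a *: x) = rnorm (a : R[i]^o) * rnorm x.
Proof.
by apply: (@complexI R); rewrite rmorphM/= -!rnormE normrZ.
Qed.

Lemma rnormM (a b : R[i]) :
  rnorm (a * b : R[i]^o) = rnorm (a : R[i]^o) * rnorm (b : R[i]^o).
Proof. exact: rnormZ. Qed.

Lemma rnormC (a : R) : rnorm (a%:C : R[i]^o) = `|a|.
Proof. by rewrite /rnorm normc_def/= expr0n/= addr0 sqrtr_sqr. Qed.

Lemma ler_distD_rnorm (V : normedModType R[i]) (z x y : V) :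
  rnorm (x - y) <= rnorm (x - z) + rnorm (z - y).
Proof. by have := ler_rnormD (x - z) (z - y); rewrite addrA subrK. Qed.

Lemma complete_rnorm (V : completeNormedModType R[i]) (u : nat -> V) :
  (forall e : R, 0 < e -> exists N, forall m n, (N <= m)%N -> (N <= n)%N ->
    rnorm (u m - u n) < e) ->
  exists l, forall e : R, 0 < e -> exists N, forall n, (N <= n)%N ->
    rnorm (u n - l) < e.
Proof.
move=> uC.
have : cauchy (u @ \oo).
  apply/cauchy_ballP => e e0.
  have [r er] : exists r : R, e = r%:C by exists (complex.Re e); rewrite RRe_real// gtr0_real.
  have r0 : 0 < r by move: e0; rewrite er ltcR.
  have [N HN] := uC _ r0.

  near_simpl; exists ([set n | (N <= n)%N], [set n | (N <= n)%N]) => /=.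
    by split; exists N.
  by move=> [m n] [] /= Nm Nn; rewrite -ball_normE /= rnormE er ltcR; apply: HN.
move=> /cauchy_cvg/cvg_ex[l ul]; exists l => e e0.
have e0' : 0 < e%:C by rewrite ltcR.
have /cvgrPdistC_lt/(_ _ e0')[N _ HN] := ul.
by exists N => n Nn; rewrite -ltcR -rnormE; apply: HN.
Qed.

Lemma dense_rnorm (V : normedModType R[i]) (S : set V) : dense S ->
  forall v (e : R), 0 < e -> exists s, S s /\ rnorm (v - s) < e.
Proof.
move=> dS v e e0; have e0' : 0 < e%:C by rewrite ltcR.
have [s [vs Ss]] : ball v e%:C `&` S !=set0.
  by apply: dS; [exists v; apply: ballxx | apply: ball_open].
by exists s; split=> //; move: vs; rewrite -ball_normE /= rnormE ltcR.
Qed.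
End RealNorm.

(** * Inner products *)

Section InnerProduct.
Context {R : realType} {V : hilbertType R}.
Implicit Types x y z : V.

Local Notation C := R[i].

Lemma innerC x y : inner x y = (inner y x)^*%C.
Proof. by have := hermC (@inner R V) x y; rewrite expr0 mul1r. Qed.

Lemma innerDl x y z : inner (x + y) z = inner x z + inner y z.
Proof. exact: (@linearDl C V V C _ _ inner). Qed.

Lemma innerZl a x y : inner (a *: x) y = a * inner x y.
Proof. exact: (@linearZl_LR C V V C _ _ inner). Qed.

Lemma innerDr x y z : inner z (x + y) = inner z x + inner z y.
Proof. exact: (@linearDr C V V C _ _ inner). Qed.

Lemma innerZr a x y : inner x (a *: y) = a^*%C * inner x y.
Proof. exact: (@linearZr_LR C V V C _ _ inner). Qed.

Lemma inner0l x : inner 0 x = 0. Proof. exact: (@linear0l C V V C _ _ inner). Qed.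
Lemma inner0r x : inner x 0 = 0. Proof. exact: (@linear0r C V V C _ _ inner). Qed.

Lemma innerNl x y : inner (- x) y = - inner x y.
Proof. exact: (@linearNl C V V C _ _ inner). Qed.

Lemma innerNr x y : inner x (- y) = - inner x y.
Proof. exact: (@linearNr C V V C _ _ inner). Qed.

Lemma innerBl x y z : inner (x - y) z = inner x z - inner y z.
Proof. by rewrite innerDl innerNl. Qed.

Lemma innerBr x y z : inner z (x - y) = inner z x - inner z y.
Proof. by rewrite innerDr innerNr. Qed.

Lemma inner_suml I (r : seq I) (P : pred I) (F : I -> V) z :
  inner (\sum_(i <- r | P i) F i) z = \sum_(i <- r | P i) inner (F i) z.
Proof. exact: (@linear_sumlz C V V C _ _ inner). Qed.

Lemma inner_sumr I (r : seq I) (P : pred I) (F : I -> V) z :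
  inner z (\sum_(i <- r | P i) F i) = \sum_(i <- r | P i) inner z (F i).
Proof. exact: (@linear_sumr C V V C _ _ inner). Qed.

Lemma inner_rnorm x : inner x x = (rnorm x ^+ 2)%:C.
Proof. by rewrite inner_normE rnormE rmorphXn. Qed.

Lemma inner_eq0 x : inner x x = 0 -> x = 0.
Proof.
rewrite inner_rnorm => /(congr1 (@complex.Re R))/= /eqP.
by rewrite sqrf_eq0 => /eqP/rnorm_eq0.
Qed.

Lemma inner_eq0C x y : inner x y = 0 -> inner y x = 0.
Proof. by rewrite innerC => /eqP; rewrite conjc_eq0 => /eqP. Qed.

Lemma inner_injl x y : (forall z, inner x z = inner y z) -> x = y.
Proof.
move=> xy; apply/eqP; rewrite -subr_eq0; apply/eqP/inner_eq0.
by rewrite innerBl xy subrr.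
Qed.

Lemma inner_injr x y : (forall z, inner z x = inner z y) -> x = y.
Proof. by move=> xy; apply: inner_injl => z; rewrite innerC xy -innerC. Qed.

Lemma sqr_rnormD x y :
  rnorm (x + y) ^+ 2 = rnorm x ^+ 2 + rnorm y ^+ 2 + 2 * complex.Re (inner x y).
Proof.
have := inner_rnorm (x + y); rewrite innerDl !innerDr !inner_rnorm (innerC y x).
case: (inner x y) => a b /(congr1 (@complex.Re R)) /=; lra.
Qed.

Lemma parallelogram x y :
  rnorm (x + y) ^+ 2 + rnorm (x - y) ^+ 2 = 2 * (rnorm x ^+ 2 + rnorm y ^+ 2).
Proof. by rewrite !sqr_rnormD rnormN innerNr raddfN/=; lra. Qed.

Lemma pythagoras x y : inner x y = 0 ->
  rnorm (x + y) ^+ 2 = rnorm x ^+ 2 + rnorm y ^+ 2.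
Proof. by move=> xy; rewrite sqr_rnormD xy /=; lra. Qed.

Lemma pythagoras_seq (T : Type) (F : T -> V) (s : seq T) :
  pairwise (fun p q => inner (F p) (F q) == 0) s ->
  rnorm (\sum_(p <- s) F p) ^+ 2 = \sum_(p <- s) rnorm (F p) ^+ 2.
Proof.
elim: s => [|p s IH] /=; first by rewrite !big_nil rnorm0 expr0n.
move=> /andP[ps /IH{}IH]; rewrite !big_cons pythagoras ?IH// inner_sumr.
elim: s ps {IH} => [|q s IH] /=; first by rewrite big_nil.
by move=> /andP[/eqP pq /IH]; rewrite big_cons pq add0r.
Qed.

(** The component of [x] orthogonal to [y] witnesses the inequality. *)
Lemma cauchy_schwarz x y : rnorm (inner x y : C^o) <= rnorm x * rnorm y.
Proof.
have [->|/eqP y0] := eqVneq y 0; first by rewrite inner0r !rnorm0 mulr0.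
have ny := rnorm_gt0 y0.
have iy : inner y y != 0 by apply/eqP => /inner_eq0.
pose p := (inner x y / inner y y) *: y.
have px : inner p (x - p) = 0.
  apply: inner_eq0C; rewrite /p innerZr innerBl innerZl.
  by rewrite divfK// subrr mulr0.
have : rnorm p <= rnorm x.
  rewrite -(@ler_pXn2r _ 2)// ?nnegrE ?rnorm_ge0//.
  by have := pythagoras px; rewrite addrC subrK => ->; rewrite lerDl sqr_ge0.
rewrite /p rnormZ -(ler_pM2r ny); apply: le_trans.
rewrite -[in X in X <= _](divfK iy (inner x y)) rnormM inner_rnorm rnormC.
by rewrite ger0_norm ?sqr_ge0// expr2 mulrA.
Qed.

End InnerProduct.

(** * Bounded operators: Riesz representation, adjoints, extension *)

Section Elementary.
Context {R : realType}.

Lemma invS_small (e : R) : 0 < e ->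
  exists N, forall n, (N <= n)%N -> (n.+1%:R)^-1 < e.
Proof.
by move=> e0; have [N _ HN] := near_infty_natSinv_lt (PosNum e0); exists N.
Qed.

Lemma rnorm_small_eq0 (V : normedModType R[i]) (x : V) :
  (forall e : R, 0 < e -> rnorm x < e) -> x = 0.
Proof.
by move=> xe; apply: contrapT => /rnorm_gt0/xe; rewrite ltxx.
Qed.

Lemma line_projection (V : hilbertType R) (x y : V) : y <> 0 ->
  exists c : R[i], inner (x - c *: y) y = 0 /\ inner x y = c * inner y y.
Proof.
move=> y0; have iy : inner y y != 0 by apply/eqP => /inner_eq0.
exists (inner x y / inner y y).
by rewrite innerBl innerZl divfK// subrr.
Qed.

End Elementary.

Section ClosestPoint.
Context {R : realType} {V : hilbertType R}.

Definition subspace (S : set V) :=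
  S 0 /\ forall (a : R[i]) x y, S x -> S y -> S (a *: x + y).

Definition adherent (S : set V) (x : V) :=
  forall e : R, 0 < e -> exists s, S s /\ rnorm (x - s) < e.

Lemma subspaceD S x y : subspace S -> S x -> S y -> S (x + y).
Proof. by move=> [_ SZ] Sx Sy; rewrite -[x]scale1r; apply: SZ. Qed.

Lemma subspaceZ S a x : subspace S -> S x -> S (a *: x).
Proof. by move=> [S0 SZ] Sx; rewrite -[_ *: _]addr0; apply: SZ. Qed.

(** A minimising sequence is Cauchy by the parallelogram identity.  The residual
    is orthogonal to [S] since a non-zero component along some [s] in [S] could
    be removed to come closer. *)
Lemma closest_point (S : set V) (v : V) : subspace S ->
  exists p, adherent S p /\ forall s, S s -> inner s (v - p) = 0.
Proof.
move=> Ssub; have [S0 _] := Ssub.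
pose D := [set rnorm (v - s) ^+ 2 | s in S].
have D0 : has_inf D.
  split; first by exists (rnorm (v - 0) ^+ 2); exists 0.
  by exists 0 => _ [s _ <-]; apply: sqr_ge0.
have dle s : S s -> inf D <= rnorm (v - s) ^+ 2.
  by move=> Ss; apply: ge_inf; [case: D0 | exists s].
have /choice[u Hu] n : exists s, S s /\ rnorm (v - s) ^+ 2 < inf D + n.+1%:R^-1.
  have n0 : (0 : R) < n.+1%:R^-1 by rewrite invr_gt0.
  have [_ [s Ss <-] sn] := inf_adherent n0 D0.
  by exists s.
have uB m n : rnorm (u m - u n) ^+ 2 <= 2 * (m.+1%:R^-1 + n.+1%:R^-1).
  have [Sm lm] := Hu m; have [Sn ln] := Hu n.
  have := parallelogram (v - u n) (v - u m).
  have -> : v - u n - (v - u m) = u m - u n.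
    by rewrite opprB addrC addrA subrK.
  (* the midpoint of [u n] and [u m] stays in [S], hence at distance >= inf D *)
  have -> : v - u n + (v - u m) = 2 *: (v - 2^-1 *: (u n + u m)).
    rewrite scalerBr scalerA divff// scale1r [2 *: v]scaler_nat mulr2n.
    by rewrite opprD addrACA.
  rewrite rnormZ exprMn.
  have -> : rnorm (2 : R[i]^o) = 2.
    have -> : (2 : R[i]) = (2 : R)%:C by rewrite rmorphMn/= rmorph1.
    by rewrite rnormC normr_nat.
  have Sa : S (2^-1 *: (u n + u m)).
    by apply: subspaceZ => //; apply: subspaceD.
  move=> par; have dl := dle _ Sa; move: lm ln dl par.
  by move: (m.+1%:R^-1 : R) (n.+1%:R^-1 : R) => dm dn; lra.
have [l ul] : exists l, forall e : R, 0 < e -> exists N, forall n, (N <= n)%N ->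
    rnorm (u n - l) < e.
  apply: complete_rnorm => e e0.
  have e4 : 0 < e ^+ 2 / 4 by rewrite divr_gt0// exprn_gt0.
  have [N HN] := invS_small e4; exists N => m n Nm Nn.
  rewrite -(@ltr_pXn2r _ 2)// ?nnegrE ?rnorm_ge0 ?(ltW e0)//.
  apply: le_lt_trans (uB m n) _.
  by move: (HN m Nm) (HN n Nn); move: (m.+1%:R^-1 : R) (n.+1%:R^-1 : R) => a b; lra.
exists l; split.
  move=> e /ul[N HN]; exists (u N); split; first by case: (Hu N).
  by rewrite rnormBC; apply: HN.
move=> s Ss; have [->|/eqP s0] := eqVneq s 0; first by rewrite inner0l.
have ns := rnorm_gt0 s0.
have near n : rnorm (inner s (v - u n) : R[i]^o) ^+ 2
              <= rnorm s ^+ 2 * n.+1%:R^-1.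
  have [Sn ln] := Hu n; have [c [cs cE]] := line_projection (v - u n) s0.
  have -> : inner s (v - u n) = (inner (v - u n) s)^*%C by rewrite -innerC.
  have -> (z : R[i]) : rnorm (z^*%C : R[i]^o) = rnorm (z : R[i]^o).
    by rewrite /rnorm normcJ.
  rewrite cE rnormM inner_rnorm rnormC ger0_norm ?sqr_ge0//.
  have cs' : inner (v - u n - c *: s) (c *: s) = 0 by rewrite innerZr cs mulr0.
  have := pythagoras cs'; rewrite subrK rnormZ.
  have Sa : S (u n + c *: s) by apply: subspaceD => //; apply: subspaceZ.
  have := dle _ Sa; rewrite opprD addrA => h1 h2.
  have h3 : (rnorm (c : R[i]^o) * rnorm s) ^+ 2 <= n.+1%:R^-1.
    by move: h1 h2 ln; move: (n.+1%:R^-1 : R) => dn; lra.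
  rewrite [rnorm s ^+ 2]expr2 mulrA exprMn mulrC -expr2.
  by rewrite ler_pM2l ?exprn_gt0.
apply: (@rnorm_small_eq0 R R[i]^o) => e e0.
have e2 : 0 < e / 2 by rewrite divr_gt0.
have [N1 HN1] := ul _ (divr_gt0 e2 ns).
have e3 : 0 < (e / 2 / rnorm s) ^+ 2 by rewrite exprn_gt0// divr_gt0.
have [N2 HN2] := invS_small e3.
pose n := maxn N1 N2.
have -> : inner s (v - l) = inner s (v - u n) + inner s (u n - l).
  by rewrite -innerDr addrA subrK.
apply: le_lt_trans (ler_rnormD _ _) _.
rewrite [e]splitr ltrD//.
  rewrite -(@ltr_pXn2r _ 2)// ?nnegrE ?rnorm_ge0 ?(ltW e2)//.
  apply: le_lt_trans (near n) _.
  rewrite -ltr_pdivlMl ?exprn_gt0// mulrC -exprVn -exprMn.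
  by apply: HN2; apply: leq_maxr.
apply: le_lt_trans (cauchy_schwarz _ _) _.
rewrite -ltr_pdivlMl// mulrC; apply: HN1; exact: leq_maxl.
Qed.

End ClosestPoint.

Section Riesz.
Context {R : realType}.
Implicit Types V W : hilbertType R.

(** The representing vector spans the orthogonal complement of the kernel. *)
Lemma riesz V (f : V -> R[i]) (M : R) :
  (forall a x y, f (a *: x + y) = a * f x + f y) ->
  (forall x, rnorm (f x : R[i]^o) <= M * rnorm x) ->
  exists z, forall x, f x = inner x z.
Proof.
move=> fL fM.
have f0 : f 0 = 0.
  have := fL (-1) 0 0; rewrite scaler0 addr0 mulN1r addNr; exact.
have fZ a x : f (a *: x) = a * f x by have := fL a x 0; rewrite !addr0 f0 addr0.
have fB x y : f (x - y) = f x - f y.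
  by have := fL (-1) y x; rewrite scaleN1r mulN1r addrC => ->; rewrite addrC.
have kS : subspace [set x | f x = 0].
  by split=> // a x y /= fx fy; rewrite fL fx fy mulr0 addr0.
have [fall|/existsNP[v /eqP fv]] := pselect (forall x, f x = 0).
  by exists 0 => x; rewrite inner0r fall.
have [p [pS pO]] := closest_point v kS.
have M1 : 0 < `|M| + 1 by rewrite ltr_pwDr.
have fp : f p = 0.
  apply: (@rnorm_small_eq0 R R[i]^o) => e e0.
  have [s [/= fs ps]] := pS _ (divr_gt0 e0 M1).
  have -> : f p = f (p - s) by rewrite fB fs subr0.
  apply: le_lt_trans (fM _) _.
  apply: (@le_lt_trans _ _ ((`|M| + 1) * rnorm (p - s))).
    apply: ler_wpM2r; first exact: rnorm_ge0.
    by have := ler_norm M; lra.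
  by rewrite mulrC -ltr_pdivlMr.
set w := v - p; have fw : f w = f v by rewrite fB fp subr0.
have w0 : w <> 0 by move=> w0; move: fv; rewrite -fw w0 f0 eqxx.
have iw : inner w w != 0 by apply/eqP => /inner_eq0.
exists ((f w / inner w w)^*%C *: w) => x.
rewrite innerZr conjcK.
have : inner (x - (f x / f w) *: w) w = 0.
  by apply: pO => /=; rewrite fB fZ divfK ?subrr// fw.
rewrite innerBl innerZl => /eqP; rewrite subr_eq0 => /eqP ->.
by rewrite mulrC -mulrA (mulrC (inner w w)) divfK// divfK// fw.
Qed.

Section BoundedLinear.
Context {V W : hilbertType R} (f : V -> W) (fB : bounded_linear f).

Lemma blP a x y : f (a *: x + y) = a *: f x + f y. Proof. exact: fB.1. Qed.

Lemma blD x y : f (x + y) = f x + f y.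
Proof. by have := blP 1 x y; rewrite !scale1r. Qed.

Lemma bl0 : f 0 = 0.
Proof. by have := blP (-1) 0 0; rewrite scaler0 addr0 scaleN1r addNr. Qed.

Lemma blZ a x : f (a *: x) = a *: f x.
Proof. by have := blP a x 0; rewrite bl0 !addr0. Qed.

Lemma blN x : f (- x) = - f x.
Proof. by rewrite -scaleN1r blZ scaleN1r. Qed.

Lemma blB x y : f (x - y) = f x - f y.
Proof. by rewrite blD blN. Qed.

Lemma bl_bound : exists2 M : R, 0 < M & forall x, rnorm (f x) <= M * rnorm x.
Proof.
have [_ [M HM]] := fB; exists (`|M| + 1); first by rewrite ltr_pwDr.
move=> x; have := HM x; rewrite !rnormE -rmorphM/= lecR => /le_trans; apply.
by apply: ler_wpM2r; [exact: rnorm_ge0 | have := ler_norm M; lra].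
Qed.

End BoundedLinear.

Lemma bounded_linear_rnorm V W (f : V -> W) (M : R) :
  (forall a x y, f (a *: x + y) = a *: f x + f y) ->
  (forall x, rnorm (f x) <= M * rnorm x) -> bounded_linear f.
Proof.
move=> fL fM; split; first exact: fL.
by exists M => x; rewrite !rnormE -rmorphM/= lecR.
Qed.

Lemma bounded_linear_id V : bounded_linear (@id V).
Proof. by apply: (@bounded_linear_rnorm _ _ _ 1) => // x; rewrite mul1r. Qed.

Lemma bounded_linear_comp (U : hilbertType R) V W (f : V -> W) (g : U -> V) :
  bounded_linear f -> bounded_linear g -> bounded_linear (f \o g).
Proof.
move=> fB gB; have [M M0 fM] := bl_bound fB; have [N N0 gN] := bl_bound gB.
apply: (@bounded_linear_rnorm _ _ _ (M * N)) => [a x y|x] /=.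
  by rewrite (blP gB) (blP fB).
by rewrite (le_trans (fM _))// -mulrA ler_wpM2l ?(ltW M0).
Qed.

Lemma adjoint_unique V W (f : V -> W) (g : W -> V) :
  (forall x y, inner (f x) y = inner x (g y)) -> adjoint f = g.
Proof.
move=> fg; apply/funext => y; rewrite /adjoint.
set P := [set z | _].
have /= Pget : P (get P) by apply: getPex; exists (g y) => x.
by apply: inner_injr => x; rewrite -Pget fg.
Qed.

(** [adjoint f y] represents the functional that sends [x] to [<f x, y>]. *)
Lemma adjointP V W (f : V -> W) : bounded_linear f ->
  forall x y, inner (f x) y = inner x (adjoint f y).
Proof.
move=> fB x y; rewrite /adjoint.
set P := [set z | _]; suff /(_ x) : P (get P) by [].
apply: getPex; have [M M0 fM] := bl_bound fB.
apply: (@riesz _ _ (M * rnorm y)) => [a u v|u].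
  by rewrite (blP fB) innerDl innerZl.
apply: le_trans (cauchy_schwarz _ _) _.
by rewrite mulrAC ler_wpM2r ?rnorm_ge0.
Qed.

Lemma adjointPr V W (f : V -> W) : bounded_linear f ->
  forall x y, inner x (f y) = inner (adjoint f x) y.
Proof. by move=> fB x y; rewrite innerC (adjointP fB) -innerC. Qed.

Lemma adjoint_bounded V W (f : V -> W) :
  bounded_linear f -> bounded_linear (adjoint f).
Proof.
move=> fB; have [M M0 fM] := bl_bound fB.
apply: (@bounded_linear_rnorm _ _ _ M) => [a x y|y].
  apply: inner_injr => z.
  by rewrite -(adjointP fB) !innerDr !innerZr -!(adjointP fB).
set z := adjoint f y.
have [->|/eqP z0] := eqVneq z 0.
  by rewrite rnorm0 mulr_ge0 ?(ltW M0) ?rnorm_ge0.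
rewrite -(ler_pM2r (rnorm_gt0 z0)) -expr2.
have : inner z z = inner (f z) y by rewrite (adjointP fB).
rewrite inner_rnorm => /(congr1 (fun c : R[i] => rnorm (c : R[i]^o))).
rewrite rnormC ger0_norm ?sqr_ge0// => ->.
apply: le_trans (cauchy_schwarz _ _) _.
by rewrite mulrAC ler_wpM2r ?rnorm_ge0.
Qed.

Lemma adjointK V W (f : V -> W) :
  bounded_linear f -> adjoint (adjoint f) = f.
Proof. by move=> fB; apply: adjoint_unique => x y; rewrite -(adjointPr fB). Qed.

End Riesz.

Section Extension.
Context {R : realType}.
Implicit Types V W : hilbertType R.

Definition total_family V (I : Type) (v : I -> V) :=
  forall z, (forall i, inner (v i) z = 0) -> z = 0.

(** Lists of pairs make sense over any index type; an index may be repeated. *)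
Definition lincomb V (I : Type) (v : I -> V) (l : seq (R[i] * I)) : V :=
  \sum_(p <- l) p.1 *: v p.2.

Lemma lincombP V I (v : I -> V) a l l' :
  a *: lincomb v l + lincomb v l' =
  lincomb v ([seq (a * p.1, p.2) | p <- l] ++ l').
Proof.
rewrite /lincomb big_cat big_map/= scaler_sumr; congr (_ + _).
by apply: eq_bigr => p _; rewrite scalerA.
Qed.

Lemma subspace_lincomb V I (v : I -> V) : subspace (range (lincomb v)).
Proof.
split; first by exists [::] => //; rewrite /lincomb big_nil.
move=> a _ _ [l _ <-] [l' _ <-]; rewrite lincombP.
by eexists; last reflexivity.
Qed.

Lemma lincomb1 V I (v : I -> V) i : lincomb v [:: (1, i)] = v i.
Proof. by rewrite /lincomb big_seq1 scale1r. Qed.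

Lemma total_dense V I (v : I -> V) : total_family v ->
  forall x (e : R), 0 < e -> exists l, rnorm (x - lincomb v l) < e.
Proof.
move=> vT x e e0; have [p [pS pO]] := closest_point x (subspace_lincomb v).
have xp : x = p.
  apply/eqP; rewrite -subr_eq0; apply/eqP/vT => i; apply: pO.
  by exists [:: (1, i)] => //; rewrite lincomb1.
by have [_ [[l _ <-] xl]] := pS _ e0; exists l; rewrite xp.
Qed.

(** Applied to the adjoints this needs no approximation: the difference of the
    two adjoints takes values orthogonal to the family. *)
Lemma eq_on_total V W I (v : I -> V) (f g : V -> W) : total_family v ->
  bounded_linear f -> bounded_linear g -> (forall i, f (v i) = g (v i)) -> f = g.
Proof.
move=> vT fB gB fg; apply/funext => x; apply: inner_injl => y.
rewrite (adjointP fB) (adjointP gB).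
suff -> : adjoint f y = adjoint g y by [].
apply/eqP; rewrite -subr_eq0; apply/eqP/vT => i.
by rewrite innerBr -(adjointP fB) -(adjointP gB) fg subrr.
Qed.

(** The value of the extension at [x] is the only [y] with
    [|y - sum c_i w_i| <= M |x - sum c_i v_i|] for all finite sums: completeness
    gives its existence, and linearity holds since this relation is linear. *)
Lemma bounded_extension V W (I : Type) (v : I -> V) (w : I -> W) (M : R) :
  total_family v ->
  (forall l, rnorm (lincomb w l) <= M * rnorm (lincomb v l)) ->
  exists h : V -> W, bounded_linear h /\ forall i, h (v i) = w i.
Proof.
move=> vT wM0.
have [N N0 wM] : exists2 N, 0 < N &
    forall l, rnorm (lincomb w l) <= N * rnorm (lincomb v l).
  exists (`|M| + 1) => [|l]; first by rewrite ltr_pwDr.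
  apply: le_trans (wM0 l) _.
  by apply: ler_wpM2r; [exact: rnorm_ge0 | have := ler_norm M; lra].
have lincombB (U : hilbertType R) (t : I -> U) l l' : lincomb t l - lincomb t l' =
    lincomb t ([seq (-1 * p.1, p.2) | p <- l'] ++ l).
  by rewrite -lincombP scaleN1r addrC.
have wMB l l' : rnorm (lincomb w l - lincomb w l') <=
    N * rnorm (lincomb v l - lincomb v l') by rewrite !lincombB.
pose Q x y := forall l, rnorm (y - lincomb w l) <= N * rnorm (x - lincomb v l).
have Qex x : exists y, Q x y.
  have /choice[l Hl] n : exists l, rnorm (x - lincomb v l) < n.+1%:R^-1.
    by apply: total_dense.
  have [y Hy] : exists y, forall e : R, 0 < e -> exists K, forall n,
      (K <= n)%N -> rnorm (lincomb w (l n) - y) < e.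
    apply: complete_rnorm => e e0.
    have e1 : 0 < e / N / 2 by rewrite !divr_gt0.
    have [K HK] := invS_small e1; exists K => m n Km Kn.
    apply: le_lt_trans (wMB _ _) _; rewrite mulrC -ltr_pdivlMr//.
    apply: le_lt_trans (ler_distD_rnorm x _ _) _.
    rewrite [_ / N]splitr ltrD//.
      by rewrite rnormBC (lt_trans (Hl m))// HK.
    by rewrite (lt_trans (Hl n))// HK.
  exists y => k; apply/ler_addgt0Pr => e e0.
  have e2 : 0 < e / 2 by rewrite divr_gt0.
  have [K1 HK1] := Hy _ e2; have [K2 HK2] := invS_small (divr_gt0 e2 N0).
  pose n := maxn K1 K2.
  have h1 := HK1 n (leq_maxl _ _); have h2 := HK2 n (leq_maxr _ _).
  have h3 : N * rnorm (x - lincomb v (l n)) <= e / 2.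
    by rewrite mulrC -ler_pdivlMr// ltW// (lt_trans (Hl n)).
  have h4 := ler_distD_rnorm (lincomb w (l n)) y (lincomb w k).
  have h5 : N * rnorm (lincomb v (l n) - lincomb v k) <=
      N * rnorm (lincomb v (l n) - x) + N * rnorm (x - lincomb v k).
    by rewrite -mulrDr ler_pM2l// ler_distD_rnorm.
  move: (wMB (l n) k) h1 h3 h4 h5; rewrite (rnormBC _ x) (rnormBC _ y).
  lra.
have Quniq x y y' : Q x y -> Q x y' -> y = y'.
  move=> xy xy'; apply/eqP; rewrite -subr_eq0; apply/eqP/rnorm_small_eq0 => e e0.
  have e2 : 0 < e / 2 / N by rewrite !divr_gt0.
  have [l xl] := total_dense vT x e2.
  have h1 : N * rnorm (x - lincomb v l) < e / 2 by rewrite mulrC -ltr_pdivlMr.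
  have h2 := ler_distD_rnorm (lincomb w l) y y'.
  move: (xy l) (xy' l) h1 h2; rewrite (rnormBC y').
  lra.
have /choice[h hQ] := Qex.
have hv i : h (v i) = w i.
  apply: Quniq (hQ (v i)) _ => l.
  by have := wMB [:: (1, i)] l; rewrite !lincomb1.
exists h; split => //; apply: (@bounded_linear_rnorm _ _ _ _ N); last first.
  by move=> x; have := hQ x [::]; rewrite /lincomb !big_nil !subr0.
move=> a x x'; apply: Quniq (hQ _) _ => k; apply/ler_addgt0Pr => e e0.
pose A := rnorm (a : R[i]^o).
have A1 : 0 < A + 1 by rewrite ltr_pwDr// rnorm_ge0.
have e1 : 0 < e / 2 / N / (A + 1) by rewrite !divr_gt0.
set e' := e / 2 / N / (A + 1) in e1.
have [l xl] := total_dense vT x e1; have [l' xl'] := total_dense vT x' e1.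
have ee : N * ((A + 1) * e') = e / 2.
  by rewrite /e' [(A + 1) * _]mulrC divfK ?gt_eqF// mulrC divfK ?gt_eqF.
have [m vm wm] : exists2 m, lincomb v m = a *: lincomb v l + lincomb v l' &
    lincomb w m = a *: lincomb w l + lincomb w l'.
  by eexists; rewrite lincombP; reflexivity.
have split3 (U : hilbertType R) (y y' s s' : U) :
    rnorm (a *: y + y' - (a *: s + s')) <= A * rnorm (y - s) + rnorm (y' - s').
  by rewrite opprD addrACA -scalerBr (le_trans (ler_rnormD _ _))// rnormZ.
have h1 := split3 _ (h x) (h x') (lincomb w l) (lincomb w l').
have h2 := split3 _ x x' (lincomb v l) (lincomb v l').
have h3 := ler_distD_rnorm (lincomb w m) (a *: h x + h x') (lincomb w k).
have h4 := ler_distD_rnorm (a *: x + x') (lincomb v m) (lincomb v k).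
have A0 : 0 <= A by exact: rnorm_ge0.
have h5 : A * rnorm (h x - lincomb w l) <= A * (N * rnorm (x - lincomb v l)).
  exact: ler_wpM2l A0 _ _ (hQ x l).
have h6 := hQ x' l'.
have h7 : A * rnorm (x - lincomb v l) + rnorm (x' - lincomb v l') <= (A + 1) * e'.
  by rewrite mulrDl mul1r lerD ?(ltW xl')// ler_wpM2l ?(ltW xl).
have h8 := wMB m k.
rewrite -wm in h1; rewrite -vm in h2; rewrite (rnormBC (lincomb v m) (a *: x + x')) in h4.
have h9 : N * (A * rnorm (x - lincomb v l) + rnorm (x' - lincomb v l')) <= e / 2.
  by rewrite -ee ler_pM2l.
have h10 : N * rnorm (lincomb v m - lincomb v k) <=
    N * (A * rnorm (x - lincomb v l) + rnorm (x' - lincomb v l')) +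
    N * rnorm (a *: x + x' - lincomb v k).
  by rewrite -mulrDr ler_pM2l// (le_trans h4)// lerD2r.
have h11 : A * (N * rnorm (x - lincomb v l)) = N * (A * rnorm (x - lincomb v l)).
  by rewrite mulrCA.
lra.
Qed.

(** Equal Gram matrices make corresponding finite sums equal in norm. *)
Lemma isometric_extension V W (I : Type) (v : I -> V) (w : I -> W) :
  total_family v ->
  (forall i j, inner (w i) (w j) = inner (v i) (v j)) ->
  exists h : V -> W, [/\ bounded_linear h, forall i, h (v i) = w i &
    forall x y, inner (h x) (h y) = inner x y].
Proof.
move=> vT vw.
have [l|h [hB hv]] := @bounded_extension V W I v w 1 vT.
  rewrite mul1r -(@ler_pXn2r _ 2)// ?nnegrE ?rnorm_ge0// -lecR -!inner_rnorm.
  rewrite /lincomb !inner_suml le_eqVlt; apply/orP; left; apply/eqP.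
  apply: eq_bigr => p _; rewrite !inner_sumr; apply: eq_bigr => q _.
  by rewrite !innerZl !innerZr vw.
exists h; split=> // x y.
have hh : adjoint h \o h = id.
  have aB := adjoint_bounded hB.
  apply: (eq_on_total vT) => [||i]; first exact: bounded_linear_comp.
    exact: bounded_linear_id.
  apply/eqP; rewrite -subr_eq0; apply/eqP/vT => j /=.
  by rewrite innerBr -(adjointP hB) !hv vw subrr.
by rewrite (adjointP hB) -[adjoint h (h y)]/((adjoint h \o h) y) hh.
Qed.

End Extension.

(** * Hilbert tensor products of bounded operators *)

Section Tensors.
Context {R : realType}.

Section OneTensor.
Context {V W : hilbertType R} (VW : hilbertTensor V W).
Local Notation T := (tensor VW).

Lemma tensorPl a x x' y : T (a *: x + x') y = a *: T x y + T x' y.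
Proof. exact: (@linearPl _ V W VW _ _ T). Qed.

Lemma tensorPr a x y y' : T x (a *: y + y') = a *: T x y + T x y'.
Proof. exact: (@linearPr _ V W VW _ _ T). Qed.

Lemma tensorZl a x y : T (a *: x) y = a *: T x y.
Proof. exact: (@linearZl_LR _ V W VW _ _ T). Qed.

Lemma tensorZr a x y : T x (a *: y) = a *: T x y.
Proof. exact: (@linearZr_LR _ V W VW _ _ T). Qed.

Lemma tensor0l y : T 0 y = 0.
Proof. exact: (@linear0l _ V W VW _ _ T). Qed.

Lemma tensor0r x : T x 0 = 0.
Proof. exact: (@linear0r _ V W VW _ _ T). Qed.

Lemma rnorm_tensor x y : rnorm (T x y) = rnorm x * rnorm y.
Proof.
apply: (@pexpIrn _ 2%N) => //; rewrite ?nnegrE ?mulr_ge0 ?rnorm_ge0//.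
apply: (@complexI R); rewrite -inner_rnorm tensorE !inner_rnorm exprMn.
by rewrite -rmorphM.
Qed.

Lemma tensor_total : total_family (fun p : V * W => T p.1 p.2).
Proof.
move=> z zT; apply/inner_eq0/(@rnorm_small_eq0 R R[i]^o) => e e0.
have n1 : 0 < rnorm z + 1 by rewrite ltr_pwDr// rnorm_ge0.
have [s [/= [n [x [y sE]]] zs]] := dense_rnorm (@tensor_dense R V W VW) z (divr_gt0 e0 n1).
have -> : inner z z = inner (z - s) z.
  rewrite innerBl sE inner_suml [X in _ - X]big1 ?subr0// => i _.
  exact: (zT (x i, y i)).
apply: le_lt_trans (cauchy_schwarz _ _) _.
apply: (@le_lt_trans _ _ (rnorm (z - s) * (rnorm z + 1))).
  by rewrite ler_wpM2l ?rnorm_ge0// lerDl.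
by rewrite -ltr_pdivlMr.
Qed.

Lemma bounded_tensorl x : bounded_linear (T x).
Proof.
apply: (@bounded_linear_rnorm _ _ _ _ (rnorm x)) => [a y y'|y].
  exact: tensorPr.
by rewrite rnorm_tensor.
Qed.

Lemma bounded_tensorr y : bounded_linear (T^~ y).
Proof.
apply: (@bounded_linear_rnorm _ _ _ _ (rnorm y)) => [a x x'|x].
  exact: tensorPl.
by rewrite rnorm_tensor mulrC.
Qed.

(** One leg at a time: the operators [x |-> x (x) y] and [y |-> x (x) y] have
    adjoints, which a vector orthogonal to all products kills. *)
Lemma total_tensor I J (u : I -> V) (v : J -> W) :
  total_family u -> total_family v ->
  total_family (fun p : I * J => T (u p.1) (v p.2)).
Proof.
move=> uT vT z zT; apply: tensor_total => -[x y] /=.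
have uz i : adjoint (T (u i)) z = 0.
  by apply: vT => j; rewrite -(adjointP (bounded_tensorl _)) (zT (i, j)).
suff yz : adjoint (T^~ y) z = 0.
  by rewrite (adjointP (bounded_tensorr y)) yz inner0r.
apply: uT => i; rewrite -(adjointP (bounded_tensorr y)).
by rewrite (adjointP (bounded_tensorl (u i))) uz inner0r.
Qed.

End OneTensor.

Section GramSchmidt.
Context {V W : hilbertType R}.

(** Unbundled, so that it applies to the flipped tensor product and to the
    composite of a tensor product with an operator on one leg. *)
Definition bilinear_map (U : lmodType R[i]) (B : V -> W -> U) :=
  (forall a x x' y, B (a *: x + x') y = a *: B x y + B x' y) /\
  (forall a x y y', B x (a *: y + y') = a *: B x y + B x y').

Definition orthogonal_legs (m : seq (V * W)) :=
  pairwise (fun p q => inner p.2 q.2 == 0) m.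

(** Rewriting an element of an algebraic tensor product so that its second
    legs are pairwise orthogonal; legs may vanish, so nothing is normalised. *)
Lemma gram_schmidt (l : seq (V * W)) : exists2 m, orthogonal_legs m &
  forall (U : lmodType R[i]) (B : V -> W -> U), bilinear_map B ->
    \sum_(p <- l) B p.1 p.2 = \sum_(p <- m) B p.1 p.2.
Proof.
elim: l => [|[a b] l [m mo mB]]; first by exists [::].
pose c (p : V * W) := inner b p.2 / inner p.2 p.2.
pose r := b - \sum_(p <- m) c p *: p.2.
have rm q : q \in m -> inner r q.2 = 0.
  move=> qm; move: mo; rewrite /orthogonal_legs /r.
  case/splitPr: qm => m1 m2; rewrite pairwise_cat/= => /and3P[/allrelP m12 _ /andP[/allP qm2 _]].
  rewrite innerBl inner_suml big_cat big_cons/= big_seq big1 => [|p pm1]; last first.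
    by rewrite innerZl (eqP (m12 p q pm1 (mem_head _ _))) mulr0.
  rewrite add0r big_seq [X in _ - (_ + X)]big1 => [|p pm2]; last first.
    by rewrite innerZl (inner_eq0C (eqP (qm2 p pm2))) mulr0.
  rewrite addr0 innerZl /c.
  have [->|/eqP q0] := eqVneq q.2 0; first by rewrite !inner0r mulr0 subrr.
  by rewrite divfK ?subrr//; apply/eqP => /inner_eq0.
exists ((a, r) :: [seq (p.1 + c p *: a, p.2) | p <- m]).
  rewrite /orthogonal_legs /= pairwise_map all_map; apply/andP; split => //.
  by apply/allP => q qm /=; rewrite rm.
move=> U B BB; have [Bl Br] := BB.
have B0 x : B x 0 = 0.
  by have := Br (-1) x 0 0; rewrite scaler0 addr0 scaleN1r addNr.
have BZ t x y : B x (t *: y) = t *: B x y by rewrite -[t *: y]addr0 Br B0 addr0.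
have BD x y y' : B x (y + y') = B x y + B x y'.
  by rewrite -[y in y + _]scale1r Br scale1r.
have Bsum x : B x (\sum_(p <- m) c p *: p.2) = \sum_(p <- m) c p *: B x p.2.
  apply: (big_ind2 (fun y z => B x y = z)) => [|y z y' z' <- <-|p _].
  - exact: B0.
  - exact: BD.
  - exact: BZ.
rewrite !big_cons big_map/= (mB _ _ BB).
have -> : B a b = B a r + \sum_(p <- m) c p *: B a p.2.
  by rewrite -Bsum -BD subrK.
rewrite -addrA -big_split/=; congr (_ + _); apply: eq_bigr => p _.
by rewrite [p.1 + _]addrC Bl.
Qed.


End GramSchmidt.

(** Once the second legs are orthogonal the norms of both sides are sums of
    squares, compared term by term. *)
Lemma contraction_leg (V V' W U U' : hilbertType R) (B : V -> W -> U)
    (B' : V' -> W -> U') (f : V -> V') (M : R) :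
  bilinear_map B -> bilinear_map B' ->
  (forall x y x' y', inner (B x y) (B x' y') = inner x x' * inner y y') ->
  (forall x y x' y', inner (B' x y) (B' x' y') = inner x x' * inner y y') ->
  bounded_linear f -> 0 < M -> (forall x, rnorm (f x) <= M * rnorm x) ->
  forall l : seq (V * W), rnorm (\sum_(p <- l) B' (f p.1) p.2) <=
    M * rnorm (\sum_(p <- l) B p.1 p.2).
Proof.
move=> BB BB' BE BE' fB M0 fM l; have [m mo mB] := gram_schmidt l.
have BBf : bilinear_map (fun x y => B' (f x) y).
  by split=> [a x x' y|a x y y']; rewrite ?(blP fB) ?BB'.1 ?BB'.2.
rewrite (mB _ _ BB) (mB _ _ BBf).
have sumE (V1 U1 : hilbertType R) (B1 : V1 -> W -> U1) (h : V -> V1) :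
    (forall x y x' y', inner (B1 x y) (B1 x' y') = inner x x' * inner y y') ->
    rnorm (\sum_(p <- m) B1 (h p.1) p.2) ^+ 2 =
    \sum_(p <- m) rnorm (h p.1) ^+ 2 * rnorm p.2 ^+ 2.
  move=> B1E; rewrite pythagoras_seq.
    apply: eq_bigr => p _; apply: (@complexI R); rewrite -inner_rnorm B1E.
    by rewrite !inner_rnorm -rmorphM.
  apply: sub_pairwise mo => p q /eqP pq.
  by rewrite B1E pq mulr0.
rewrite -(@ler_pXn2r _ 2)// ?nnegrE ?mulr_ge0 ?rnorm_ge0 ?(ltW M0)//.
rewrite exprMn (sumE _ _ B id)// (sumE _ _ B' f)// big_distrr/=.
apply: ler_sum => p _; rewrite [leRHS]mulrA; apply: ler_wpM2r; first exact: sqr_ge0.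
by rewrite -exprMn ler_pXn2r ?nnegrE ?mulr_ge0 ?rnorm_ge0 ?(ltW M0).
Qed.

Lemma bilinear_tensor (V W : hilbertType R) (VW : hilbertTensor V W) :
  bilinear_map (tensor VW).
Proof. by split=> *; [apply: tensorPl | apply: tensorPr]. Qed.

Lemma bilinear_tensor_flip (V W : hilbertType R) (VW : hilbertTensor V W) :
  bilinear_map (fun y x => tensor VW x y).
Proof. by split=> *; [apply: tensorPr | apply: tensorPl]. Qed.

Lemma tensor_map_getP (V W V' W' : hilbertType R)
    (VW : hilbertTensor V W) (VW' : hilbertTensor V' W')
    (f : V -> V') (g : W -> W') :
  (exists h : VW -> VW', bounded_linear h /\
    forall x y, h (tensor VW x y) = tensor VW' (f x) (g y)) ->
  bounded_linear (tensor_map VW VW' f g) /\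
  forall x y, tensor_map VW VW' f g (tensor VW x y) = tensor VW' (f x) (g y).
Proof.
move=> hP; rewrite /tensor_map; set P := [set h | _].
exact: (getPex (P := P)).
Qed.

(** The two one-sided cases suffice for the Frobenius condition, where one of
    the tensor factors is always the identity. *)
Lemma tensor_map_idr (V W V' : hilbertType R)
    (VW : hilbertTensor V W) (VW' : hilbertTensor V' W) (f : V -> V') :
  bounded_linear f ->
  bounded_linear (tensor_map VW VW' f id) /\
  forall x y, tensor_map VW VW' f id (tensor VW x y) = tensor VW' (f x) y.
Proof.
move=> fB; apply: tensor_map_getP; have [M M0 fM] := bl_bound fB.
have [|h [hB hE]] := @bounded_extension _ _ _ _
    (fun p : V * W => tensor VW p.1 p.2)
    (fun p : V * W => tensor VW' (f p.1) p.2) M (@tensor_total V W VW).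
  move=> l; have := contraction_leg (bilinear_tensor VW) (bilinear_tensor VW')
    (@tensorE _ _ _ VW) (@tensorE _ _ _ VW') fB M0 fM
    [seq (p.1 *: p.2.1, p.2.2) | p <- l].
  rewrite /lincomb !big_map/= => H.
  under eq_bigr do rewrite -tensorZl -(blZ fB).
  by under [X in _ * rnorm X]eq_bigr do rewrite -tensorZl.
by exists h; split=> // x y; rewrite (hE (x, y)).
Qed.

Lemma tensor_map_idl (V W W' : hilbertType R)
    (VW : hilbertTensor V W) (VW' : hilbertTensor V W') (g : W -> W') :
  bounded_linear g ->
  bounded_linear (tensor_map VW VW' id g) /\
  forall x y, tensor_map VW VW' id g (tensor VW x y) = tensor VW' x (g y).
Proof.
move=> gB; apply: tensor_map_getP; have [M M0 gM] := bl_bound gB.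
have flipE (V1 W1 : hilbertType R) (VW1 : hilbertTensor V1 W1) y x y' x' :
    inner (tensor VW1 x y) (tensor VW1 x' y') = inner y y' * inner x x'.
  by rewrite tensorE mulrC.
have [|h [hB hE]] := @bounded_extension _ _ _ _
    (fun p : V * W => tensor VW p.1 p.2)
    (fun p : V * W => tensor VW' p.1 (g p.2)) M (@tensor_total V W VW).
  move=> l; have := contraction_leg (bilinear_tensor_flip VW)
    (bilinear_tensor_flip VW') (flipE _ _ VW) (flipE _ _ VW') gB M0 gM
    [seq (p.1 *: p.2.2, p.2.1) | p <- l].
  rewrite /lincomb !big_map/= => H.
  under eq_bigr do rewrite -tensorZr -(blZ gB).
  by under [X in _ * rnorm X]eq_bigr do rewrite -tensorZr.
by exists h; split=> // x y; rewrite (hE (x, y)).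
Qed.

Section Associator.
Context {U V W : hilbertType R} {UV : hilbertTensor U V} {VW : hilbertTensor V W}.
Context (UVl : hilbertTensor UV W) (UVr : hilbertTensor U VW).
Local Notation alpha := (associator UVl UVr).

(** The two families of elementary threefold tensors are total with the same
    Gram matrix, so each can be mapped isometrically to the other. *)
Lemma associator_invertible :
  [/\ bounded_linear alpha,
      bounded_linear (pinv [set: UVl] alpha),
      forall x y z, alpha (tensor UVl (tensor UV x y) z) =
                    tensor UVr x (tensor VW y z) &
      forall x y z, pinv [set: UVl] alpha (tensor UVr x (tensor VW y z)) =
                    tensor UVl (tensor UV x y) z].
Proof.
pose tl (p : (U * V) * W) := tensor UVl (tensor UV p.1.1 p.1.2) p.2.
pose tr (p : (U * V) * W) := tensor UVr p.1.1 (tensor VW p.1.2 p.2).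
have tlT : total_family tl.
  apply: (@total_tensor _ _ UVl _ _ _ id (@tensor_total _ _ UV)).
  by move=> z zT; apply/inner_eq0/zT.
have trT : total_family tr.
  move=> z zT.
  apply: (@total_tensor _ _ UVr _ _ id _ _ (@tensor_total _ _ VW)).
    by move=> t tT; apply/inner_eq0/tT.
  by move=> [x [y t]]; apply: (zT ((x, y), t)).
have E p q : inner (tl p) (tl q) = inner (tr p) (tr q).
  by rewrite /tl /tr !tensorE mulrA.
have [h [hB hE _]] := isometric_extension tlT (fun p q => esym (E p q)).
have [k [kB kE _]] := isometric_extension trT E.
have [aB aE] : bounded_linear alpha /\ forall x y z,
    alpha (tensor UVl (tensor UV x y) z) = tensor UVr x (tensor VW y z).
  rewrite /associator; set P := [set h | _].
  apply: (getPex (P := P)); exists h; split=> // x y z.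
  exact: (hE ((x, y), z)).
have ak : alpha \o k = id.
  apply: (eq_on_total trT) => [||[[x y] z]/=].
  - exact: bounded_linear_comp.
  - exact: bounded_linear_id.
  - by rewrite (kE ((x, y), z)) aE.
have ka : k \o alpha = id.
  apply: (eq_on_total tlT) => [||[[x y] z]/=].
  - exact: bounded_linear_comp.
  - exact: bounded_linear_id.
  - by rewrite aE (kE ((x, y), z)).
have pk : pinv [set: UVl] alpha = k.
  apply/funext => t.
  have {1}-> : t = alpha (k t) by rewrite -[alpha (k t)]/((alpha \o k) t) ak.
  rewrite pinvKV ?inE// => x y _ _ xy.
  by rewrite -[x]/(id x) -[y]/(id y) -ka /= xy.
by rewrite pk; split=> // x y z; apply: (kE ((x, y), z)).
Qed.

End Associator.
End Tensors.

(** * Idempotents and characters of commutative Frobenius multiplications *)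

Section FrobeniusMultiplication.
Context {R : realType} {H : hilbertType R}.
Implicit Types x y z g k p q : H.

(** The last field is the Frobenius condition read off on elements: the adjoint
    of a multiplication operator is a module map. *)
Record frobenius_mul (m : H -> H -> H) : Prop := FrobeniusMul {
  fm_bounded : forall x, bounded_linear (m x);
  fm_bound : exists2 C : R, 0 < C &
    forall x y, rnorm (m x y) <= C * (rnorm x * rnorm y);
  fm_comm : commutative m;
  fm_assoc : associative m;
  fm_adjoint : forall x a b, adjoint (m x) (m a b) = m (adjoint (m x) a) b }.

Context (m : H -> H -> H) (mF : frobenius_mul m).
Local Notation ad x := (adjoint (m x)).

Let mB := fm_bounded mF.
Let mC := fm_comm mF.
Let mA := fm_assoc mF.

Lemma fmDr x y z : m x (y + z) = m x y + m x z. Proof. exact: blD. Qed.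
Lemma fmZr a x y : m x (a *: y) = a *: m x y. Proof. exact: blZ. Qed.
Lemma fmBr x y z : m x (y - z) = m x y - m x z. Proof. exact: blB. Qed.
Lemma fm0r x : m x 0 = 0. Proof. exact: bl0. Qed.
Lemma fmDl x y z : m (x + y) z = m x z + m y z.
Proof. by rewrite mC fmDr !(mC z). Qed.
Lemma fmZl a x y : m (a *: x) y = a *: m x y.
Proof. by rewrite mC fmZr mC. Qed.
Lemma fmBl x y z : m (x - y) z = m x z - m y z.
Proof. by rewrite mC fmBr !(mC z). Qed.
Lemma fm0l x : m 0 x = 0. Proof. by rewrite mC fm0r. Qed.

Lemma adP x y z : inner (m x y) z = inner y (ad x z).
Proof. exact: adjointP. Qed.

Lemma adPr x y z : inner z (m x y) = inner (ad x z) y.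
Proof. exact: adjointPr. Qed.

Lemma adDl x y z : ad (x + y) z = ad x z + ad y z.
Proof. by apply: inner_injr => t; rewrite -adP fmDl innerDl innerDr -!adP. Qed.

Lemma adZl a x z : ad (a *: x) z = a^*%C *: ad x z.
Proof. by apply: inner_injr => t; rewrite -adP fmZl innerZl innerZr conjcK -adP. Qed.

Lemma adDr x y z : ad z (x + y) = ad z x + ad z y.
Proof. exact: blD (adjoint_bounded (mB z)) _ _. Qed.

Lemma adZr a x z : ad z (a *: x) = a *: ad z x.
Proof. exact: blZ (adjoint_bounded (mB z)) _ _. Qed.

Lemma ad_mul x a b : ad x (m a b) = m a (ad x b).
Proof. by rewrite mC (fm_adjoint mF) mC. Qed.

(** By [ad_mul] the multiplication operators are normal. *)
Lemma rnorm_ad x y : rnorm (ad x y) = rnorm (m x y).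
Proof.
apply: (@pexpIrn _ 2%N) => //; rewrite ?nnegrE ?rnorm_ge0//.
by apply: (@complexI R); rewrite -!inner_rnorm adP ad_mul -adPr.
Qed.

Definition character g :=
  g <> 0 /\ forall x y, inner (m x y) g = inner x g * inner y g.

Lemma character_adjoint g x : character g -> ad x g = (inner x g)^*%C *: g.
Proof.
by move=> [_ gM]; apply: inner_injr => y; rewrite -adP gM innerZr conjcK.
Qed.

(** An eigenvector of a normal operator is an eigenvector of its adjoint. *)
Lemma character_mul g x : character g -> m x g = inner x g *: g.
Proof.
move=> gG; have adg := character_adjoint x gG.
apply/eqP; rewrite -subr_eq0; apply/eqP/inner_eq0.
have E2 : inner (m x g) g = inner x g * inner g g.
  by rewrite adP adg innerZr conjcK.
have E3 : inner g (m x g) = (inner x g)^*%C * inner g g.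
  by rewrite adPr adg innerZl.
have E1 : inner (m x g) (m x g) = inner x g * (inner x g)^*%C * inner g g.
  by rewrite adP ad_mul adg fmZr innerZr conjcK E3 mulrA.
by rewrite innerBl !innerBr !innerZl !innerZr E1 E2 E3; ring.
Qed.

(** Computing [gh] in both orders shows that [h] is a multiple of [g] unless
    they are orthogonal, and only the multiple 1 is again a character. *)
Lemma character_orthogonal g h : character g -> character h -> g <> h ->
  inner g h = 0.
Proof.
move=> gG hG gh; apply: contrapT => /eqP gh0; apply: gh.
have E : inner g h *: h = inner h g *: g.
  by rewrite -(character_mul g hG) -(character_mul h gG) mC.
pose c := inner h g / inner g h.
have hE : h = c *: g.
  by rewrite /c mulrC -scalerA -E scalerA mulVf// scale1r.
have ig : inner g g != 0 by apply/eqP => /inner_eq0/gG.1.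
have c0 : c^*%C != 0.
  by apply/eqP => c0; move: gh0; rewrite hE innerZr c0 mul0r eqxx.
have := hG.2 g g; rewrite hE !innerZr gG.2.
move=> cE; have : c^*%C * (inner g g * inner g g) * (c^*%C - 1) = 0.
  by rewrite mulrBr mulr1 [X in _ - X]cE; ring.
move=> /eqP; rewrite !mulf_eq0 (negPf c0) (negPf ig)/= subr_eq0 => /eqP c1.
by rewrite -(conjcK c) c1 conjc1 scale1r.
Qed.

(** [gg = |g|^2 g], so a bound for the product also bounds the characters. *)
Lemma character_rnorm_le : exists2 C : R, 0 < C &
  forall g, character g -> rnorm g <= C.
Proof.
have [C C0 mle] := fm_bound mF; exists C => // g' gG.
have g0 := rnorm_gt0 gG.1.
have : rnorm (m g' g') = rnorm g' ^+ 2 * rnorm g'.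
  by rewrite character_mul// rnormZ inner_rnorm rnormC ger0_norm ?sqr_ge0.
have := mle g' g'; rewrite -expr2 => h hE; move: h; rewrite hE mulrC.
by rewrite ler_pM2r ?exprn_gt0.
Qed.

(** Stability under adjoints keeps [ad z z], and then the projection built from
    it, inside the ideal that contains [z]. *)
Definition star_ideal (K : set H) :=
  [/\ subspace K, forall x k, K k -> K (m x k), forall x k, K k -> K (ad x k) &
      forall x, adherent K x -> K x].

(** Equivalently, [p <> 0] and [m p] is an orthogonal projection that fixes [p]. *)
Definition projection p := [/\ p <> 0, m p p = p & forall x, ad p x = m p x].

(** The powers of [ad z z], suitably normalised, converge: they are the values
    at [a] of the powers of a positive contraction [A].  The limit is non-zero
    because [A] has norm 1, and so have its powers. *)
Lemma projection_normalised (K : set H) z : star_ideal K -> K z ->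
  (forall y, rnorm (m z y) <= rnorm y) ->
  (forall e : R, 0 < e -> exists y, rnorm y = 1 /\ 1 - e < rnorm (m z y)) ->
  exists p, [/\ K p, projection p & m (ad z z) p = p].
Proof.
move=> [Ksub Km Kad Kcl] Kz z1 zsup.
pose a := ad z z; pose A := m a.
have AE y : A y = ad z (m z y) by rewrite /A /a -(fm_adjoint mF).
have Ain v w : inner (A v) w = inner (m z v) (m z w).
  by rewrite AE -adPr.
have Asym v w : inner (A v) w = inner v (A w).
  by rewrite Ain adP -AE.
have Acon y : rnorm (A y) <= rnorm y.
  by rewrite AE rnorm_ad (le_trans (z1 _)).
pose u n := iter n A a.
have AzC v : A (m z v) = m z (A v) by rewrite /A !mA (mC a).
have AnzC n v : iter n A (m z v) = m z (iter n A v).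
  by elim: n => //= n ->; rewrite AzC.
have Anin n v w : inner (iter n A v) w = inner (iter n (m z) v) (iter n (m z) w).
  elim: n v w => //= n IH v w.
  by rewrite Ain -AnzC IH -!iterS !iterSr.
(* [<A^i a, A^j a>] depends only on [i + j]; it decreases as [m z] is a contraction *)
pose h n := rnorm (iter n (m z) a) ^+ 2.
have uin i j : inner (u i) (u j) = (h (i + j)%N)%:C.
  rewrite /h -inner_rnorm -Anin /u.
  by elim: j i => [|j IH] i /=; rewrite ?addn0// -Asym addnS -addSn -IH.
have hS n : h n.+1 <= h n.
  by rewrite /h /= ler_pXn2r ?nnegrE ?rnorm_ge0.
have hle i j : (i <= j)%N -> h j <= h i.
  move=> /subnK <-; elim: (j - i)%N => // k IH.
  by rewrite addSn (le_trans (hS _)).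
pose D := range h.
have D0 : has_inf D.
  by split; [exists (h 0%N), 0%N | exists 0 => _ [n _ <-]; apply: sqr_ge0].
have dle n : inf D <= h n by apply: ge_inf; [case: D0 | exists n].
have [p Hp] : exists p, forall e : R, 0 < e -> exists N, forall n, (N <= n)%N ->
    rnorm (u n - p) < e.
  apply: complete_rnorm => e e0.
  have e4 : 0 < e ^+ 2 / 2 by rewrite divr_gt0// exprn_gt0.
  have [_ [N _ <-] hN] := inf_adherent e4 D0; exists N => i j Ni Nj.
  rewrite -(@ltr_pXn2r _ 2)// ?nnegrE ?rnorm_ge0 ?(ltW e0)//.
  have -> : rnorm (u i - u j) ^+ 2 = h (i + i)%N - h (i + j)%N - (h (i + j)%N - h (j + j)%N).
    apply: (@complexI R); rewrite -inner_rnorm innerBl !innerBr !uin (addnC j i).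
    by rewrite !rmorphB.
  have h1 : h (i + i)%N <= h N by rewrite hle// (leq_trans Ni)// leq_addr.
  have h2 : h (j + j)%N <= h N by rewrite hle// (leq_trans Nj)// leq_addr.
  have h3 := dle (i + j)%N.
  lra.
have Ku n : K (u n).
  by elim: n => [|n IH]; [apply: Kad | apply: Km].
have [C C0 mle] := fm_bound mF.
have plim (x : H) : (forall n, rnorm x <= C * rnorm (u n - p) ) -> x = 0.
  move=> xle; apply: rnorm_small_eq0 => e e0.
  have [N HN] := Hp _ (divr_gt0 e0 C0).
  apply: le_lt_trans (xle N) _.
  by rewrite mulrC -ltr_pdivlMr// HN.
have Ap : A p = p.
  apply/eqP; rewrite -subr_eq0; apply/eqP/rnorm_small_eq0 => e e0.
  have [N HN] := Hp _ (divr_gt0 e0 (ltr0n _ 2)).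
  have -> : A p - p = A (p - u N) + (u N.+1 - p).
    by rewrite /A fmBr addrA subrK.
  apply: le_lt_trans (ler_rnormD _ _) _; rewrite [e]splitr ltrD ?HN//.
  by rewrite (le_lt_trans (Acon _))// rnormBC HN.
have up n : m (u n) p = p.
  by elim: n => [//|n IH]; rewrite /= /A -mA IH.
have pp : m p p = p.
  apply/eqP; rewrite -subr_eq0; apply/eqP/rnorm_small_eq0 => e e0.
  have Cp : 0 < C * (rnorm p + 1).
    by rewrite mulr_gt0// ltr_pwDr// rnorm_ge0.
  have [N HN] := Hp _ (divr_gt0 e0 Cp).
  rewrite -{3}(up N) -fmBl (le_lt_trans (mle _ _))// rnormBC.
  apply: (@le_lt_trans _ _ (rnorm (u N - p) * (C * (rnorm p + 1)))).
    rewrite mulrCA ler_wpM2l ?rnorm_ge0// ler_pM2l//; lra.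
  by rewrite -ltr_pdivlMr// HN.
have usym n v w : inner (m (u n) v) w = inner v (m (u n) w).
  elim: n v w => [|n IH] v w; first exact: Asym.
  have -> : m (u n.+1) v = A (m (u n) v) by rewrite /= /A mA.
  by rewrite Asym IH /= /A !mA (mC a).
have padj x : ad p x = m p x.
  apply: inner_injr => v; rewrite -adP.
  apply/eqP; rewrite -subr_eq0; apply/eqP/(@rnorm_small_eq0 R R[i]^o) => e e0.
  have Cp : 0 < 2 * C * (rnorm x * rnorm v + 1).
    by rewrite !mulr_gt0// ltr_pwDr// mulr_ge0 ?rnorm_ge0.
  have [N HN] := Hp _ (divr_gt0 e0 Cp).
  have -> : inner (m p v) x - inner v (m p x) =
      inner v (m (u N - p) x) - inner (m (u N - p) v) x.
    by rewrite !fmBl innerBr innerBl usym; ring.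
  apply: le_lt_trans (ler_rnormD _ _) _; rewrite rnormN.
  have h1 := cauchy_schwarz v (m (u N - p) x).
  have h2 := cauchy_schwarz (m (u N - p) v) x.
  have h3 : rnorm v * rnorm (m (u N - p) x) <=
      rnorm v * (C * (rnorm (u N - p) * rnorm x)).
    by rewrite ler_wpM2l ?rnorm_ge0.
  have h4 : rnorm (m (u N - p) v) * rnorm x <=
      C * (rnorm (u N - p) * rnorm v) * rnorm x.
    by rewrite ler_wpM2r ?rnorm_ge0.
  have h5 : rnorm (u N - p) * (2 * C * (rnorm x * rnorm v + 1)) < e.
    by rewrite -ltr_pdivlMr// HN.
  have h6 : 0 <= C * rnorm (u N - p) by rewrite mulr_ge0 ?rnorm_ge0 ?ltW.
  lra.
exists p; split=> //; first by apply: Kcl => e /Hp[N HN]; exists (u N);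
  split=> //; rewrite rnormBC HN.
split=> // p0; move: Hp; rewrite p0 => Hu.
(* If the powers tended to 0, fix [N] with [C |u N| < 1/4] and then a unit vector
   [y] with [|zy|] so close to 1 that [|z^(N+1) y| >= 1/2]. *)
have c4 : 0 < (4 * C)^-1 by rewrite invr_gt0 mulr_gt0.
have [N /(_ N (leqnn N))] := Hu _ c4; rewrite subr0 => uN.
pose e : R := (2 * N.+1%:R)^-1.
have e0 : 0 < e by rewrite invr_gt0 mulr_gt0.
have [y [y1 zy]] := zsup _ e0.
pose b n := rnorm (iter n (m z) y).
(* normality makes the norms of the iterates log-convex *)
have logconvex n : b n.+1 ^+ 2 <= b n * b n.+2.
  have -> : b n.+1 ^+ 2 = rnorm (inner (iter n (m z) y) (ad z (iter n.+1 (m z) y)) : R[i]^o).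
    by rewrite -adP inner_rnorm rnormC ger0_norm ?sqr_ge0.
  by apply: le_trans (cauchy_schwarz _ _) _; rewrite rnorm_ad.
have bS n : rnorm (m z y) * b n <= b n.+1.
  elim: n => [|n IH]; first by rewrite /b /= y1 mulr1.
  have [b0|b0] := eqVneq (b n.+1) 0; first by rewrite b0 mulr0 rnorm_ge0.
  have bp : 0 < b n.+1 by rewrite lt_neqAle eq_sym b0 rnorm_ge0.
  rewrite -(ler_pM2r bp) -mulrA -expr2.
  apply: (@le_trans _ _ (rnorm (m z y) * (b n * b n.+2))).
    by rewrite ler_wpM2l ?rnorm_ge0.
  by rewrite mulrA [leRHS]mulrC; apply: ler_wpM2r => //; apply: rnorm_ge0.
have ble n : b n <= 1.
  by elim: n => [|n IH]; [rewrite /b /= y1 | apply: le_trans (z1 _) IH].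
have bge n : 1 - n%:R * e <= b n.
  elim: n => [|n IH]; first by rewrite /b /= y1 mul0r subr0.
  have bn0 : 0 <= b n by exact: rnorm_ge0.
  have := bS n; have := ble n.
  have : 0 <= (rnorm (m z y) - (1 - e)) * b n by rewrite mulr_ge0// subr_ge0 ltW.
  have : 0 <= e * (1 - b n) by rewrite mulr_ge0 ?subr_ge0// ltW.
  rewrite -natr1; move: (n%:R : R) IH => t IH; lra.
have : b N.+1 ^+ 2 <= C * rnorm (u N).
  have -> : b N.+1 ^+ 2 = rnorm (inner (m (u N) y) y : R[i]^o).
    have -> : m (u N) y = iter N.+1 A y.
      by rewrite /u; elim: (N) => //= n IH; rewrite {1}/A -mA IH.
    by rewrite Anin inner_rnorm rnormC ger0_norm ?sqr_ge0.
  apply: le_trans (cauchy_schwarz _ _) _; rewrite y1 mulr1.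
  by apply: le_trans (mle _ _) _; rewrite y1 mulr1.
have : C * rnorm (u N) < 4^-1.
  by rewrite mulrC -ltr_pdivlMr// -invfM.
have : 2^-1 <= b N.+1.
  have := bge N.+1; rewrite /e invfM mulrCA divff ?pnatr_eq0// mulr1; lra.
move: (b N.+1) (C * _) => s t.
nra.
Qed.

Lemma rnormZr (a : R) (x : H) : 0 <= a -> rnorm (a%:C *: x) = a * rnorm x.
Proof. by move=> a0; rewrite rnormZ rnormC ger0_norm. Qed.

(** Rescale [z] by the operator norm of its multiplication operator. *)
Lemma projection_exists (K : set H) z y0 : star_ideal K -> K z -> m z y0 <> 0 ->
  exists p (s : R[i]), [/\ K p, projection p & m (ad z z) p = s *: p].
Proof.
move=> KS Kz zy0; have [Ksub _ _ _] := KS.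
have [C C0 mle] := fm_bound mF.
pose S := [set rnorm (m z y) | y in [set y | rnorm y = 1]].
have unit y : y <> 0 -> rnorm ((rnorm y)^-1%:C *: y) = 1.
  move=> y1; have := rnorm_gt0 y1 => n0.
  by rewrite rnormZr ?invr_ge0 ?rnorm_ge0// mulVf// gt_eqF.
have y00 : y0 <> 0 by move=> y00; apply: zy0; rewrite y00 fm0r.
have Ssup : has_sup S.
  split; first by eexists; exists ((rnorm y0)^-1%:C *: y0); [apply: unit|].
  exists (C * rnorm z) => _ [y /= y1 <-].
  by have := mle z y; rewrite y1 mulr1.
have zle y : rnorm (m z y) <= sup S * rnorm y.
  have [->|/eqP y1] := eqVneq y 0; first by rewrite fm0r !rnorm0 mulr0.
  have n0 := rnorm_gt0 y1; rewrite -ler_pdivrMr// mulrC.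
  rewrite -rnormZr ?invr_ge0 ?rnorm_ge0// -fmZr.
  apply: ub_le_sup; first by case: Ssup.
  by exists ((rnorm y)^-1%:C *: y) => //; apply: unit.
have s0 : 0 < sup S.
  have := zle y0; have := rnorm_gt0 zy0 => h1 h2.
  by have := lt_le_trans h1 h2; rewrite pmulr_lgt0//; apply: rnorm_gt0.
set s := sup S in zle s0.
have Vs0 : 0 <= s^-1 by rewrite invr_ge0 ltW.
have [||e e0|p [Kp pP ap]] := @projection_normalised K (s^-1%:C *: z) KS.
- exact: subspaceZ.
- by move=> y; rewrite fmZl rnormZr// mulrC ler_pdivrMr// mulrC.
- have es : 0 < s * e by rewrite mulr_gt0.
  have [_ [y /= y1 <-] sy] := sup_adherent es Ssup.
  exists y; split=> //; rewrite fmZl rnormZr// mulrC ltr_pdivlMr//.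
  by move: sy; rewrite -/s; lra.
exists p, (s ^+ 2)%:C; split=> //.
rewrite -{2}ap adZl adZr !fmZl !scalerA conjc_real -!rmorphM/=.
rewrite expr2 -!mulrA mulVKf ?gt_eqF// mulfV ?gt_eqF//.
by rewrite rmorph1 scale1r.
Qed.

(** Squared norms add up over orthogonal projections and are at least
    [1 / C^2], so a projection whose squared norm is less than twice the infimum
    cannot be split. *)
Lemma primitive_projection (K : set H) : star_ideal K ->
  (exists p, K p /\ projection p) ->
  exists p, [/\ K p, projection p &
    forall q, K q -> projection q -> m q p = q -> q = p].
Proof.
move=> [Ksub _ _ _] [p0 [Kp0 p0P]].
have [C C0 mle] := fm_bound mF.
pose S := [set rnorm p ^+ 2 | p in [set p | K p /\ projection p]].
have Sinf : has_inf S.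
  split; first by exists (rnorm p0 ^+ 2); exists p0.
  by exists 0 => _ [p _ <-]; apply: sqr_ge0.
have Sle p : K p -> projection p -> inf S <= rnorm p ^+ 2.
  by move=> Kp pP; apply: ge_inf; [case: Sinf | exists p].
have S0 : 0 < inf S.
  apply: (@lt_le_trans _ _ (C ^- 2)); first by rewrite invr_gt0 exprn_gt0.
  apply: lb_le_inf; first by case: Sinf.
  move=> _ [p /= [_ [p1 pp _]] <-]; have n0 := rnorm_gt0 p1.
  rewrite -exprVn ler_pXn2r ?nnegrE ?rnorm_ge0 ?invr_ge0 ?(ltW C0)//.
  have := mle p p; rewrite pp mulrA -[leLHS]mul1r ler_pM2r// => Cp.
  by rewrite -(ler_pM2l C0) divff ?gt_eqF.
have [_ [p /= [Kp pP] <-] plt] := inf_adherent S0 Sinf.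
exists p; split=> // q Kq qP qp; apply: contrapT => nqp.
have [[p1 pp pa] [q1 qq qa]] := (pP, qP).
have rP : projection (p - q).
  split.
  - by move=> /eqP; rewrite subr_eq0 => /eqP pq; apply: nqp.
  - by rewrite fmBl !fmBr pp qp (mC p) qp qq subrr subr0.
  - by move=> x; rewrite -scaleN1r adDl adZl rmorphN1 fmDl fmZl pa qa.
have Kr : K (p - q) by rewrite -scaleN1r; apply: subspaceD => //; apply: subspaceZ.
have qr : inner q (p - q) = 0.
  by rewrite -{1}qq adP qa fmBr qp qq subrr inner0r.
have := pythagoras qr; rewrite addrC subrK => pE.
have := Sle _ Kq qP; have := Sle _ Kr rP.
by move: plt pE; lra.
Qed.

(** Below a primitive projection [p] every [ad z z] is a multiple of [p], so by
    polarisation the ideal [pH] is the line [Cp] and yields a character. *)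
Lemma character_exists (K : set H) z y : star_ideal K -> K z -> m z y <> 0 ->
  exists g, K g /\ character g.
Proof.
move=> KS Kz zy; have [p0 [_ [Kp0 p0P _]]] := projection_exists KS Kz zy.
have [p [Kp pP pprim]] := primitive_projection KS (ex_intro _ p0 (conj Kp0 p0P)).
have [p1 pp pa] := pP; have [Ksub Km Kad Kcl] := KS.
(* the corner [pH] of [K], as an ideal of its own *)
pose Kp' := [set x | K x /\ m x p = x].
have Kp'S : star_ideal Kp'.
  split.
  - split; first by split; [case: Ksub | rewrite fm0l].
    move=> a u v [Ku up] [Kv vp]; split; first exact: Ksub.2.
    by rewrite fmDl fmZl up vp.
  - by move=> x k [Kk kp]; split; [apply: Km | rewrite -mA kp].
  - by move=> x k [Kk kp]; split; [apply: Kad | rewrite -(fm_adjoint mF) kp].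
  move=> x xK; split.
    by apply: Kcl => e /xK[k [[Kk _] xk]]; exists k.
  apply/eqP; rewrite -subr_eq0; apply/eqP/rnorm_small_eq0 => e e0.
  have [M M0 pM] := bl_bound (mB p).
  have M1 : 0 < M + 1 by rewrite ltr_pwDr// ltW.
  have [k [[Kk kp] xk]] := xK _ (divr_gt0 e0 M1).
  have -> : m x p - x = m p (x - k) + (k - x).
    by rewrite fmBr !(mC p) kp addrA subrK.
  apply: le_lt_trans (ler_rnormD _ _) _.
  rewrite (rnormBC k x); have := pM (x - k).
  by move: xk; rewrite ltr_pdivlMr//; lra.
(* the projection built from [u] lies in [pH], so it is [p] itself *)
have line u : m u p = u -> K u -> exists s : R[i], ad u u = s *: p.
  move=> up Ku; have [u0|u0] := pselect (m u p = 0).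
    by exists 0; rewrite -up u0 scale0r; apply: bl0 (adjoint_bounded (mB _)).
  have [q [s [[Kq qp] qP aq]]] := projection_exists Kp'S (conj Ku up) u0.
  have qE := pprim q Kq qP qp; exists s.
  by rewrite -qE -aq qE -(fm_adjoint mF) up.
have pH u : m u p = u -> K u -> exists s : R[i], u = s *: p.
  move=> up Ku.
  have pu : ad p u = u by rewrite pa mC.
  have app : ad p p = p by rewrite pa.
  have up1 : m (u + p) p = u + p by rewrite fmDl up pp.
  have up2 : m (u + 'i%C *: p) p = u + 'i%C *: p by rewrite fmDl fmZl up pp.
  have K1 : K (u + p) by apply: subspaceD.
  have K2 : K (u + 'i%C *: p) by apply: subspaceD => //; apply: subspaceZ.
  have [s0 E0] := line _ up Ku.
  have [s1] := line _ up1 K1.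
  rewrite adDl !adDr E0 app pu => E1.
  have [s2] := line _ up2 K2.
  rewrite adDl !adDr !adZl !adZr E0 app pu => E2.
  (* polarisation with [u + p] and [u + i p], using [ad p u = u] *)
  have iN : 'i%C^*%C = - 'i%C :> R[i] by simpc.
  have ii : (- 'i%C) * 'i%C = 1 :> R[i] by rewrite mulNr -expr2 sqr_i opprK.
  have i0 : 2 * 'i%C != 0 :> R[i].
    rewrite mulf_neq0 ?pnatr_eq0//; apply/eqP => i0.
    by move: ii => /eqP; rewrite i0 mulr0 eq_sym oner_eq0.
  rewrite iN scalerA ii scale1r in E2.
  exists ((2 * 'i%C)^-1 * ('i%C * (s1 - s0 - 1) - (s2 - s0 - 1))).
  apply: inner_injl => t.
  have := congr1 (inner^~ t) E1; have := congr1 (inner^~ t) E2.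
  rewrite !innerDl !innerZl => {}E2 {}E1.
  have e1 : (s1 - s0 - 1) * inner p t = inner (ad u p) t + inner u t.
    by rewrite !mulrBl -E1; ring.
  have e2 : (s2 - s0 - 1) * inner p t = 'i%C * inner (ad u p) t - 'i%C * inner u t.
    by rewrite !mulrBl -E2; ring.
  apply: (mulfI i0); rewrite -(mulrA (2 * 'i%C)^-1) mulVKf//.
  by rewrite mulrBl -(mulrA 'i%C (s1 - s0 - 1)) e1 e2; ring.
have mxp x : m x p = (inner x p / inner p p) *: p.
  have [s sE] : exists s : R[i], m x p = s *: p.
    by apply: pH; [rewrite -mA pp | apply: Km].
  have ip : inner p p != 0 by apply/eqP => /inner_eq0.
  rewrite sE; congr (_ *: _); apply: (mulIf ip); rewrite divfK//.
  by rewrite -innerZl -sE mC adP pa pp.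
have ip : inner p p != 0 by apply/eqP => /inner_eq0.
exists ((inner p p)^-1 *: p); split; first exact: subspaceZ.
split=> [/eqP|x x'].
  by rewrite scaler_eq0 invr_eq0 (negPf ip)/= => /eqP.
have cp : ((inner p p)^-1)^*%C = (inner p p)^-1.
  by rewrite conjc_inv -innerC.
rewrite !innerZr cp.
have -> : inner (m x x') p = inner x p * inner x' p / inner p p.
  have -> : inner (m x x') p = inner (m (m x x') p) p.
    by rewrite [m (m x x') p]mC [RHS]adP pa pp.
  by rewrite -mA mxp fmZr mxp !innerZl; field.
by field.
Qed.

Definition annihilator : set H :=
  [set k | forall g, character g -> inner k g = 0].

Lemma star_ideal_annihilator : star_ideal annihilator.
Proof.
split.
- split=> [g gG|a x y xK yK g gG]; first exact: inner0l.
  by rewrite innerDl innerZl xK// yK// mulr0 addr0.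
- by move=> x k kK g gG; rewrite gG.2 kK// mulr0.
- by move=> x k kK g gG; rewrite -adPr character_mul// innerZr kK// mulr0.
move=> x xK g gG; apply: (@rnorm_small_eq0 R R[i]^o) => e e0.
have [k [kK xk]] := xK _ (divr_gt0 e0 (rnorm_gt0 gG.1)).
have -> : inner x g = inner (x - k) g by rewrite innerBl kK// subr0.
apply: le_lt_trans (cauchy_schwarz _ _) _.
by rewrite -ltr_pdivlMr//; apply: rnorm_gt0 gG.1.
Qed.

(** Otherwise the common kernel of the characters would contain one. *)
Lemma mul_annihilator k x : annihilator k -> m x k = 0.
Proof.
move=> kK; rewrite mC; apply: contrapT => kx.
have [g [gK gG]] := character_exists star_ideal_annihilator kK kx.
exact: gG.1 (inner_eq0 (gK g gG)).
Qed.

(** The adjoint of multiplication by [x] also kills [k], by normality. *)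
Lemma inner_mul_annihilator k x y : annihilator k -> inner (m x y) k = 0.
Proof.
move=> kK; rewrite adP (_ : ad x k = 0) ?inner0r//.
by apply: rnorm_eq0; rewrite rnorm_ad mul_annihilator// rnorm0.
Qed.

End FrobeniusMultiplication.

(** Characters determine the part of a product in their closed span; the part
    orthogonal to the characters vanishes. *)
Lemma frobenius_mul_unique (R : realType) (H : hilbertType R)
    (m m' : H -> H -> H) : frobenius_mul m -> frobenius_mul m' ->
  character m = character m' -> forall x y, m x y = m' x y.
Proof.
move=> mF mF' E x y; apply/eqP; rewrite -subr_eq0; apply/eqP/inner_eq0.
have dK : annihilator m (m x y - m' x y).
  move=> g gG; rewrite innerBl gG.2; have gG' : character m' g by rewrite -E.
  by rewrite gG'.2 subrr.
have dK' : annihilator m' (m x y - m' x y) by move: dK; rewrite /annihilator E.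
rewrite innerBl.
by rewrite (inner_mul_annihilator mF)// (inner_mul_annihilator mF')// subrr.
Qed.

(** * Frobenius semigroups and their group-like elements *)

Section FrobeniusSemigroups.
Context {R : realType} {H : hilbertType R} {HH : hilbertTensor H H}.
Context (HHl : hilbertTensor HH H) (HHr : hilbertTensor H HH).
Implicit Types (mu : HH -> H) (X : set H).
Local Notation T := (tensor HH).
Local Notation mul := Defs.mul.

Section FromFrobenius.
Context mu (muF : frobenius HHl HHr mu).

Lemma frobenius_bounded : bounded_linear mu.
Proof. by case: muF => -[]. Qed.

Let muB := frobenius_bounded.

Lemma mul_bounded x : bounded_linear (mul mu x).
Proof.
exact: (bounded_linear_comp muB (bounded_tensorl HH x)).
Qed.

(** On elementary tensors the first Frobenius equation reads
    [Delta (x y) = (L_x (x) id) (Delta y)], where [Delta] is the adjoint of [mu];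
    pairing it with [a (x) b] gives the condition on elements. *)
Lemma frobenius_mul_of : frobenius_mul (mul mu).
Proof.
have [[_ muA muC] E _] := muF; have DB := adjoint_bounded muB.
split=> // [x||x a b]; first exact: mul_bounded.
  have [M M0 muM] := bl_bound muB; exists M => // x y.
  by rewrite -(rnorm_tensor HH); apply: muM.
have [aB piB aE piE] := associator_invertible HHl HHr.
have [lB lE] := tensor_map_idr HHl HH muB.
have [rB rE] := tensor_map_idl HH HHr DB.
have [PB PE] := tensor_map_idr HH HH (mul_bounded x).
have coE y : adjoint mu (mul mu x y) = tensor_map HH HH (mul mu x) id (adjoint mu y).
  rewrite /mul -[LHS]/((adjoint mu \o mu) (T x y)) -E /= rE.
  have := @eq_on_total _ _ _ _ _ (tensor_map HHl HH mu id \o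
    (pinv [set: HHl] (associator HHl HHr) \o tensor HHr x))
    (tensor_map HH HH (mul mu x) id) (tensor_total (VW := HH)).
  move=> /(_ _ PB _)/(congr1 (@^~ (adjoint mu y))); apply.
    apply: bounded_linear_comp => //; apply: bounded_linear_comp => //.
    exact: bounded_tensorl.
  by move=> [u v] /=; rewrite piE lE PE.
apply: inner_injr => y; rewrite -(adjointP (mul_bounded x)).
rewrite {2}/mul (adjointPr muB) coE (adjointP PB).
rewrite [in RHS]/mul (adjointPr muB).
suff -> : adjoint (tensor_map HH HH (mul mu x) id) (T a b) =
    T (adjoint (mul mu x) a) b by [].
apply/eqP; rewrite -subr_eq0; apply/eqP/(tensor_total (VW := HH)) => -[u v] /=.
rewrite innerBr -(adjointP PB) PE !tensorE (adjointP (mul_bounded x)).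
by rewrite subrr.
Qed.

(** Pair [Delta g = g (x) g] with elementary tensors. *)
Lemma group_likeE : group_like mu = character (mul mu).
Proof.
apply/seteqP; split=> g [g0 gE]; split=> //.
  by move=> x y; rewrite /mul (adjointP muB) gE tensorE.
apply/eqP; rewrite -subr_eq0; apply/eqP/(tensor_total (VW := HH)) => -[u v] /=.
by rewrite innerBr -(adjointP muB) tensorE [inner (mu _) _]gE subrr.
Qed.

Lemma group_like_orthogonal : orthogonal_set (group_like mu).
Proof.
rewrite group_likeE; split=> [x []//|x y].
exact: (character_orthogonal frobenius_mul_of).
Qed.

Lemma group_like_bounded : bounded_above (group_like mu).
Proof.
rewrite group_likeE; have [C C0 CP] := character_rnorm_le frobenius_mul_of.
by exists C; split=> // x /CP; rewrite rnormE lecR.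
Qed.

End FromFrobenius.

Lemma eq_mul mu mu' : bounded_linear mu -> bounded_linear mu' ->
  (forall x y, mul mu x y = mul mu' x y) -> mu = mu'.
Proof.
move=> muB muB' E; apply: (eq_on_total (tensor_total (VW := HH))) => // -[x y].
exact: E.
Qed.

Lemma group_like_inj mu mu' : frobenius HHl HHr mu -> frobenius HHl HHr mu' ->
  group_like mu = group_like mu' -> mu = mu'.
Proof.
move=> muF muF'; rewrite (group_likeE muF) (group_likeE muF') => E.
apply: eq_mul; [exact: frobenius_bounded muF|exact: frobenius_bounded muF'|].
exact: frobenius_mul_unique (frobenius_mul_of muF) (frobenius_mul_of muF') E.
Qed.

Section ToFrobenius.
Context X (Xorth : orthogonal_set X) (Xbd : bounded_above X).

Definition perp : set H := [set k | forall g, X g -> inner k g = 0].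

Lemma perpC k g : perp k -> X g -> inner g k = 0.
Proof. by move=> kX /kX/inner_eq0C. Qed.

(** The family [X], completed by its orthogonal complement and padded by 0 so
    that its index type is [H]. *)
Lemma orthogonal_perp_total : total_family
  (fun x => if `[< X x \/ perp x >] then x else 0).
Proof.
move=> z zT; apply: inner_eq0; have zp : perp z.
  move=> g Xg; apply: inner_eq0C; have := zT g.
  by case: asboolP => // -[]; left.
by have := zT z; case: asboolP => // -[]; right.
Qed.

(** Collecting the terms of a linear combination that belong to the same
    member of the family. *)
Lemma lincomb_uniq (I : eqType) (l : seq (R[i] * I)) :
  exists2 l' : seq (R[i] * I), uniq (map snd l') &
    forall (V : hilbertType R) (v : I -> V), lincomb v l = lincomb v l'.
Proof.
elim: l => [|[c i] l [l' ul' lE]]; first by exists [::].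
exists ((c + \sum_(p <- l' | p.2 == i) p.1, i) :: [seq p <- l' | p.2 != i]).
  rewrite /= -[X in uniq X](filter_map snd (predC1 i)) filter_uniq// andbT.
  by rewrite -[X in _ \notin X](filter_map snd (predC1 i)) mem_filter/= eqxx.
move=> V v; rewrite /lincomb !big_cons/= big_filter -/(lincomb v l) lE /lincomb.
rewrite [in LHS](bigID (fun p => p.2 == i))/= addrA scalerDl; congr (_ + _ + _).
by rewrite scaler_suml; apply: eq_bigr => p /eqP ->.
Qed.

(** As [X] is orthogonal and bounded by some [C], the sum of the [c_g g (x) g] has
    the norm of the sum of the [c_g |g| g], at most [C] times that of the sum of
    the [c_g g]. *)
Lemma comultiplication_exists : exists D : H -> HH,
  [/\ bounded_linear D, forall g, X g -> D g = T g g &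
      forall k, perp k -> D k = 0].
Proof.
have [C [C0 XC]] := Xbd; have [X0 Xo] := Xorth.
pose v x := if `[< X x \/ perp x >] then x else 0.
pose w x := if `[< X x >] then T x x else 0.
have [l|D [DB DE]] := @bounded_extension _ _ _ _ v w C orthogonal_perp_total.
  have [l' ul' lE] := lincomb_uniq l; rewrite !lE.
  (* [F] keeps the terms with index in [X]; the rest is orthogonal to them *)
  pose F (p : R[i] * H) := if `[< X p.2 >] then p.1 *: p.2 else 0.
  have Fo p q : p.2 != q.2 -> inner (F p) (F q) = 0.
    rewrite /F; case: asboolP => Xp; last by rewrite inner0l.
    case: asboolP => Xq; last by rewrite inner0r.
    by move=> /eqP pq; rewrite innerZl innerZr Xo// !mulr0.
  have po : pairwise (fun p q : R[i] * H => p.2 != q.2) l'.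
    by move: ul'; rewrite uniq_pairwise pairwise_map.
  have nw : rnorm (lincomb w l') ^+ 2 =
      \sum_(p <- l') rnorm (p.1 *: w p.2) ^+ 2.
    apply: pythagoras_seq; apply: sub_pairwise po => p q pq.
    rewrite /w; case: asboolP => Xp; last by rewrite scaler0 inner0l.
    case: asboolP => Xq; last by rewrite scaler0 inner0r.
    by rewrite innerZl innerZr tensorE Xo ?mul0r ?mulr0//; apply/eqP.
  have nF : rnorm (\sum_(p <- l') F p) ^+ 2 = \sum_(p <- l') rnorm (F p) ^+ 2.
    by apply: pythagoras_seq; apply: sub_pairwise po => p q /Fo ->.
  have Fle : rnorm (\sum_(p <- l') F p) <= rnorm (lincomb v l').
    rewrite -(@ler_pXn2r _ 2)// ?nnegrE ?rnorm_ge0//.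
    have -> : lincomb v l' = \sum_(p <- l') F p + \sum_(p <- l') (p.1 *: v p.2 - F p).
      by rewrite -big_split/=; apply: eq_bigr => p _; rewrite addrC subrK.
    rewrite pythagoras; first by rewrite lerDl sqr_ge0.
    rewrite inner_suml big1// => p _; rewrite inner_sumr big1// => q _.
    rewrite /F; case: asboolP => Xp; last by rewrite inner0l.
    rewrite /v; case: (asboolP (X q.2)) => Xq; last first.
      by case: asboolP => [[//|Xq']|_]; rewrite ?scaler0 ?subrr ?inner0r//
        subr0 innerZl innerZr (perpC Xq' Xp) !mulr0.
    rewrite ifT ?subrr ?inner0r//; apply/asboolP; by left.
  apply: (@le_trans _ _ (C * rnorm (\sum_(p <- l') F p))); last first.
    by rewrite ler_pM2l.
  rewrite -(@ler_pXn2r _ 2)// ?nnegrE ?mulr_ge0 ?rnorm_ge0 ?(ltW C0)//.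
  rewrite exprMn nw nF big_distrr/=; apply: ler_sum => p _.
  rewrite /w /F; case: asboolP => Xp; last by rewrite scaler0 !rnorm0 expr0n mulr0.
  rewrite !rnormZ rnorm_tensor !exprMn [leRHS]mulrCA.
  apply: ler_wpM2l; first exact: sqr_ge0.
  apply: ler_wpM2r; first exact: sqr_ge0.
  rewrite ler_pXn2r ?nnegrE ?rnorm_ge0 ?(ltW C0)//.
  by have := XC _ Xp; rewrite rnormE lecR.
exists D; split=> // x xX.
  have := DE x; rewrite /v /w ifT; last by apply/asboolP; left.
  by rewrite ifT//; apply/asboolP.
have := DE x; rewrite /v ifT; last by apply/asboolP; right.
rewrite /w; case: asboolP => // Xx.
by have /inner_eq0/(X0 _ Xx) := xX x Xx.
Qed.

(** [mu] is the adjoint of the comultiplication above: [<xy, g> = <x, g><y, g>]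
    for [g] in [X] and [<xy, k> = 0] for [k] orthogonal to [X].  All axioms are
    checked on [X] and on its orthogonal complement. *)
Lemma frobenius_exists : exists2 mu, frobenius HHl HHr mu & group_like mu = X.
Proof.
have [D [DB DX Dp]] := comultiplication_exists; have [X0 Xo] := Xorth.
pose mu := adjoint D; have muB : bounded_linear mu := adjoint_bounded DB.
have muD : adjoint mu = D := adjointK DB.
have sep (a b : H) : (forall g, X g -> inner a g = inner b g) ->
    (forall k, perp k -> inner a k = inner b k) -> a = b.
  move=> aX ap; apply/eqP; rewrite -subr_eq0; apply/eqP/orthogonal_perp_total => x.
  case: asboolP => [[Xx|px]|_]; last exact: inner0l.
    by apply: inner_eq0C; rewrite innerBl aX// subrr.
  by apply: inner_eq0C; rewrite innerBl ap// subrr.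
have mX x y g : X g -> inner (mul mu x y) g = inner x g * inner y g.
  by move=> Xg; rewrite /mul (adjointP muB) muD DX// tensorE.
have mp x y k : perp k -> inner (mul mu x y) k = 0.
  by move=> pk; rewrite /mul (adjointP muB) muD Dp// inner0r.
have mC : commutative (mul mu).
  move=> x y; apply: sep => [g Xg|k pk]; first by rewrite !mX// mulrC.
  by rewrite !mp.
have mA : associative (mul mu).
  move=> x y z; apply: sep => [g Xg|k pk]; first by rewrite !mX// mulrA.
  by rewrite !mp.
have mg x g : X g -> mul mu x g = inner x g *: g.
  move=> Xg; apply: sep => [h Xh|k pk]; last first.
    by rewrite mp// innerZl (perpC pk Xg) mulr0.
  rewrite mX// innerZl; have [<-//|gh] := pselect (g = h).
  by rewrite (Xo g h)// !mulr0.
have mk x k : perp k -> mul mu x k = 0.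
  move=> pk; apply: sep => [h Xh|k' pk']; last by rewrite mp// inner0l.
  by rewrite mX// pk// mulr0 inner0l.
have muF : frobenius HHl HHr mu.
  have [aB piB aE piE] := associator_invertible HHl HHr.
  have [l1B l1E] := tensor_map_idr HHl HH muB.
  have [r1B r1E] := tensor_map_idl HH HHr DB.
  have [l2B l2E] := tensor_map_idl HHr HH muB.
  have [r2B r2E] := tensor_map_idr HH HHl DB.
  have idT : total_family (@id H) by move=> z zT; apply/inner_eq0/zT.
  split; first by split.
    apply: (eq_on_total (total_tensor (VW := HH) idT orthogonal_perp_total)).
    - apply: bounded_linear_comp; rewrite ?muD//.
      exact: bounded_linear_comp.
    - by apply: bounded_linear_comp; rewrite ?muD.
    move=> [x y] /=; rewrite muD r1E; case: asboolP => [[Xy|py]|_].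
    + by rewrite DX// piE l1E -!/(mul mu _ _) mg// tensorZl (blZ DB) DX.
    + rewrite Dp// tensor0r (bl0 piB) (bl0 l1B).
      by rewrite -[mu _]/(mul mu x y) mk// (bl0 DB).
    + by rewrite (bl0 DB) !tensor0r (bl0 piB) (bl0 l1B) (bl0 muB) (bl0 DB).
  apply: (eq_on_total (total_tensor (VW := HH) orthogonal_perp_total idT)).
  - by apply: bounded_linear_comp; rewrite ?muD.
  - apply: bounded_linear_comp; rewrite ?muD//.
    exact: bounded_linear_comp.
  move=> [x y] /=; rewrite muD r2E; case: asboolP => [[Xx|px]|_].
  + by rewrite (DX x)// aE l2E -!/(mul mu _ _) ![mul mu x _]mC mg// tensorZr (blZ DB) DX.
  + rewrite (Dp x)// tensor0l (bl0 aB) (bl0 l2B).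
    by rewrite -[mu _]/(mul mu x y) mC mk// (bl0 DB).
  + by rewrite (bl0 DB) !tensor0l (bl0 aB) (bl0 l2B) (bl0 muB) (bl0 DB).
exists mu => //; rewrite (group_likeE muF); apply/seteqP; split=> [h hG|g Xg].
  apply: contrapT => Xh; have ph : perp h.
    move=> g Xg; apply: (character_orthogonal (frobenius_mul_of muF)) => //.
      by split; [apply: X0|move=> x y; apply: mX].
    by move=> hg; apply: Xh; rewrite hg.
  have := hG.2 h h; rewrite mp// => /esym/eqP; rewrite mulf_eq0 orbb => /eqP.
  by move=> /inner_eq0; apply: hG.1.
by split; [apply: X0|move=> x y; apply: mX].
Qed.

End ToFrobenius.

End FrobeniusSemigroups.

(** * Radical, special and partially isometric structures *)

Section Properties.
Context {R : realType} {H : hilbertType R} {HH : hilbertTensor H H}.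
Context (HHl : hilbertTensor HH H) (HHr : hilbertTensor H HH).
Context (mu : HH -> H) (muF : frobenius HHl HHr mu).
Local Notation T := (tensor HH).
Local Notation mul := Defs.mul.
Local Notation G := (group_like mu).

Let muB := frobenius_bounded muF.
Let mF := frobenius_mul_of muF.
Let DB := adjoint_bounded muB.

Lemma group_like_character g : G g -> character (mul mu) g.
Proof. by rewrite (group_likeE muF). Qed.

Lemma perp_annihilator k : perp G k -> annihilator (mul mu) k.
Proof. by move=> kG g; rewrite -(group_likeE muF); apply: kG. Qed.

Lemma comul_perp k : perp G k -> adjoint mu k = 0.
Proof.
move=> kG; apply: (tensor_total (VW := HH)) => -[x y] /=.
rewrite -(adjointP muB).
exact: (inner_mul_annihilator mF x y (perp_annihilator kG)).
Qed.

Lemma mul_comul g : G g -> mu (adjoint mu g) = inner g g *: g.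
Proof.
move=> Gg; rewrite Gg.2 -[LHS]/(mul mu g g).
exact: (character_mul mF g (group_like_character Gg)).
Qed.

(** Modulo a maximal modular ideal every [k] orthogonal to [G] equals [uk = 0];
    conversely the kernel of each character is maximal modular. *)
Lemma jacobson_radicalE : jacobson_radical mu = perp G.
Proof.
apply/seteqP; split=> [x xJ g Gg|k kG I [[I0 IZ Imul] [u uI] _ _]]; last first.
  by have := uI k; rewrite (mul_annihilator mF u (perp_annihilator kG)) subr0.
have gC := group_like_character Gg.
have ig : inner g g != 0 by apply/eqP => /inner_eq0; apply: gC.1.
apply: (xJ [set y | inner y g = 0]); split=> /=.
- split=> [|a y z /= yg zg|y z /= zg]; first exact: inner0l.
    by rewrite innerDl innerZl yg zg mulr0 addr0.
  by rewrite gC.2 zg mulr0.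
- exists ((inner g g)^-1 *: g) => y /=.
  by rewrite innerBl gC.2 innerZl mulVf// mul1r subrr.
- move=> I; have : [set: H] g by [].
  by rewrite -I /= => /eqP; rewrite (negPf ig).
move=> J [J0 JZ _] IJ; have [[j [Jj /eqP jg]]|nJ] :=
    pselect (exists j, J j /\ inner j g <> 0); [right|left].
  apply/seteqP; split=> // y _.
  rewrite -[y](subrK ((inner y g / inner j g) *: j)) addrC.
  apply: JZ => //; apply: IJ => /=.
  by rewrite innerBl innerZl divfK// subrr.
apply/seteqP; split=> // y Jy; apply: contrapT => yg.
by apply: nJ; exists y.
Qed.

Lemma perp_group_likeP : (perp G = [set 0]) <-> total_set G.
Proof.
rewrite /total_set /perp.
have -> : [set y | forall x, G x -> inner x y = 0] =
    [set k | forall g, G g -> inner k g = 0]; last by [].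
by apply/seteqP; split=> y yG x /yG/inner_eq0C.
Qed.

Lemma semisimpleP : semisimple mu <-> total_set G.
Proof. by rewrite /semisimple jacobson_radicalE perp_group_likeP. Qed.

Lemma comul_eq0P : adjoint mu = cst 0 <-> G = set0.
Proof.
split=> [D0|G0]; last first.
  by apply/funext => k; apply: comul_perp => g; rewrite G0.
rewrite -subset0 => g [g0 gE]; move: gE; rewrite D0 /= => /esym g00.
apply/g0/inner_eq0/eqP.
have := inner0l (T g g); rewrite -{1}g00 tensorE => /eqP.
by rewrite mulf_eq0 orbb.
Qed.

Lemma mul_eq0P : mu = cst 0 <-> G = set0.
Proof.
rewrite -comul_eq0P; split=> E.
  apply: adjoint_unique => x y; by rewrite E inner0l inner0r.
by rewrite -(adjointK muB) E; apply: adjoint_unique => x y; rewrite inner0l inner0r.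
Qed.

Lemma radicalP : radical mu <-> G = set0.
Proof.
rewrite /radical jacobson_radicalE; split=> [pT|->]; last first.
  by apply/seteqP; split=> // x _ g.
rewrite -subset0 => g Gg; have : perp G g by rewrite pT.
by move=> /(_ g Gg)/inner_eq0; apply: Gg.1.
Qed.

Lemma orthonormal_group_likeP :
  orthonormal_set G <-> forall g, G g -> inner g g = 1.
Proof.
split=> [[_ G1] g /G1|G1].
  by rewrite inner_normE => ->; rewrite expr1n.
split; first exact: group_like_orthogonal muF.
move=> x /G1; rewrite inner_normE => /eqP.
by rewrite sqrp_eq1// => /eqP.
Qed.

Lemma group_like_eq1 (g : H) : g <> 0 -> inner g g *: g = g -> inner g g = 1.
Proof.
move=> /eqP g0; rewrite -[X in _ = X]scale1r => /eqP; rewrite -subr_eq0 -scalerBl.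
by rewrite scaler_eq0 (negPf g0) orbF subr_eq0 => /eqP.
Qed.

(** [mu] maps [Delta g] to [|g|^2 g] for [g] in [G], and [Delta] kills the
    orthogonal complement of [G]. *)
Lemma specialP : special mu <-> orthonormal_basis G.
Proof.
split=> [sp|[/orthonormal_group_likeP G1 /perp_group_likeP pG]].
  split.
    apply/orthonormal_group_likeP => g Gg; apply: group_like_eq1; first exact: Gg.1.
    by rewrite -mul_comul// -[LHS]/((mu \o adjoint mu) g) sp.
  apply/perp_group_likeP/seteqP; split=> [k kG|_ -> g _]; last exact: inner0l.
  by have := congr1 (@^~ k) sp; rewrite /= (comul_perp kG) (bl0 muB).
apply: (eq_on_total (v := fun x : {x | G x} => sval x)).
- move=> z zG; suff : perp G z by rewrite pG.
  by move=> g Gg; apply/inner_eq0C/(zG (exist _ g Gg)).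
- exact: bounded_linear_comp.
- exact: bounded_linear_id.
by move=> [g Gg] /=; rewrite mul_comul// G1// scale1r.
Qed.

Lemma partial_isometryP : partial_isometry (adjoint mu) <-> orthonormal_set G.
Proof.
rewrite orthonormal_group_likeP /partial_isometry (adjointK muB); split.
  move=> [_ E] g Gg; have := congr1 (@^~ g) E; rewrite /= mul_comul// (blZ DB) Gg.2.
  move=> /eqP; rewrite -[X in _ == X]scale1r -subr_eq0 -scalerBl scaler_eq0.
  move=> /orP[|/eqP gg]; first by rewrite subr_eq0 => /eqP.
  have := inner0l (T g g); rewrite -{1}gg tensorE => /eqP.
  by rewrite mulf_eq0 orbb => /eqP/inner_eq0/(Gg.1).
move=> G1; split=> //.
apply: (eq_on_total (orthogonal_perp_total (X := G))) => [||x] //.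
  by do 2?apply: bounded_linear_comp.
case: asboolP => [[Gx|px]|_] /=; last by rewrite !(bl0 DB, bl0 muB).
  by rewrite mul_comul// G1// scale1r.
by rewrite (comul_perp px) (bl0 muB) (bl0 DB).
Qed.

End Properties.

(** * Orthonormal bases are equipotent *)

Section OrthonormalBases.
Context {R : realType} {H : hilbertType R}.
Implicit Types X Y : set H.
Implicit Types x y : H.

Lemma orthonormal_inner X x y : orthonormal_set X -> X x -> X y ->
  inner x y = (x == y)%:R.
Proof.
move=> [[_ Xo] X1] Xx Xy; have [<-|/eqP xy] := eqVneq x y; last exact: Xo.
by rewrite inner_normE X1// expr1n.
Qed.

Lemma rnorm_conj (a : R[i]) : rnorm (a^*%C : R[i]^o) = rnorm (a : R[i]^o).
Proof. by rewrite /rnorm normcJ. Qed.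

Section Sums.
Context X (X1 : orthonormal_set X) (s : seq H) (us : uniq s).
Hypothesis sX : forall x, x \in s -> X x.

Lemma rnorm_sum_orthonormal (c : H -> R[i]) :
  rnorm (\sum_(x <- s) c x *: x) ^+ 2 = \sum_(x <- s) rnorm (c x : R[i]^o) ^+ 2.
Proof.
rewrite pythagoras_seq.
  rewrite big_seq [RHS]big_seq; apply: eq_bigr => x /sX Xx.
  have -> : rnorm (c x *: x) = rnorm (c x : R[i]^o).
    by rewrite rnormZ /rnorm X1.2//= mulr1.
  by [].
move: us; rewrite uniq_pairwise; apply: (@sub_in_pairwise _ [in s]).
  move=> x y /sX Xx /sX Xy /= /negPf xy.
  by rewrite innerZl innerZr (orthonormal_inner X1)// xy !mulr0.
exact/allP.
Qed.

Lemma projection_orthogonal y x : x \in s ->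
  inner (y - \sum_(z <- s) inner y z *: z) x = 0.
Proof.
move=> xs; rewrite innerBl inner_suml (bigD1_seq x)//= innerZl.
rewrite (orthonormal_inner X1 (sX xs) (sX xs)) eqxx mulr1 big_seq_cond big1 ?addr0 ?subrr//.
move=> z /andP[zs /negPf zx].
by rewrite innerZl (orthonormal_inner X1 (sX zs) (sX xs)) zx mulr0.
Qed.

Lemma bessel y :
  \sum_(x <- s) rnorm (inner y x : R[i]^o) ^+ 2 <= rnorm y ^+ 2.
Proof.
have o : inner (y - \sum_(z <- s) inner y z *: z) (\sum_(z <- s) inner y z *: z) = 0.
  rewrite inner_sumr big_seq big1// => z zs.
  by rewrite innerZr projection_orthogonal// mulr0.
have := pythagoras o; rewrite subrK rnorm_sum_orthonormal => ->.
by rewrite lerDr sqr_ge0.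
Qed.

(** If no member of the basis outside [s] meets [y] then [y] is in the span of
    [s] and Bessel's inequality is an equality. *)
Lemma parseval y : total_set X ->
  (forall x, X x -> inner x y != 0 -> x \in s) ->
  \sum_(x <- s) rnorm (inner y x : R[i]^o) ^+ 2 = rnorm y ^+ 2.
Proof.
move=> XT ys; rewrite -rnorm_sum_orthonormal; congr (rnorm _ ^+ 2); apply/esym.
apply/eqP; rewrite -subr_eq0; apply/eqP.
set d := _ - _; suff : [set y | forall x, X x -> inner x y = 0] d by rewrite XT.
move=> x Xx; apply: inner_eq0C; rewrite /d.
have [xs|xs] := boolP (x \in s); first exact: projection_orthogonal.
have yx : inner y x = 0.
  by apply: inner_eq0C; apply/eqP; apply: contraNT xs; apply: ys.
rewrite innerBl yx inner_suml big_seq big1 ?subrr// => z zs.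
rewrite innerZl (orthonormal_inner X1 (sX zs) Xx).
by rewrite (_ : z == x = false) ?mulr0//; apply: contraNF xs => /eqP <-.
Qed.

End Sums.

Definition neighbours Y x := [set y | Y y /\ inner x y != 0].

(** By Bessel, for each [n] only finitely many members of [Y] have a coefficient of
    squared modulus above [1 / (n + 1)]. *)
Lemma countable_neighbours Y x : orthonormal_set Y -> countable (neighbours Y x).
Proof.
move=> Y1.
pose S n := [set y | Y y /\ n.+1%:R^-1 < rnorm (inner x y : R[i]^o) ^+ 2].
have -> : neighbours Y x = \bigcup_n S n.
  apply/seteqP; split=> [y [Yy xy]|y [n _ [Yy yn]]].
    have : 0 < rnorm (inner x y : R[i]^o) ^+ 2.
      by rewrite exprn_gt0//; apply: rnorm_gt0; apply/eqP.
    by move=> /invS_small[N HN]; exists N => //; split=> //; apply: HN.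
  split=> //; apply/eqP => xy; move: yn; rewrite xy rnorm0 expr0n/=.
  by rewrite ltNge invr_ge0 ler0n.
apply: bigcup_countable => // n _; apply: finite_set_countable.
apply: contrapT => Sinf.
have [N HN] : exists N : nat, rnorm x ^+ 2 * n.+1%:R < N%:R.
  by exists (Num.bound (rnorm x ^+ 2 * n.+1%:R)); rewrite archi_boundP// mulr_ge0 ?sqr_ge0.
have [B BS BN] := infinite_set_fset N Sinf.
have BY y : y \in B -> Y y by move=> /BS[].
have := bessel Y1 (fset_uniq B) BY x; apply/negP; rewrite -ltNge.
apply: (@lt_le_trans _ _ (\sum_(y <- B) n.+1%:R^-1)); last first.
  by rewrite big_seq [leRHS]big_seq; apply: ler_sum => y /BS[_ /ltW].
rewrite big_const_seq count_predT iter_addr_0 -[ltRHS]mulr_natl ltr_pdivlMr//.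
by apply: lt_le_trans HN _; rewrite ler_nat.
Qed.

Section Blocks.
Context X Y (X1 : orthonormal_set X) (Y1 : orthonormal_set Y).
Context (XT : total_set X).

(** Summing [|<x, y>|^2] over both blocks gives the number of [y] when summed
    over [x] first (Parseval), and at most the number of [x] when summed over [y]
    first (Bessel). *)
Lemma finite_block (A B : set H) : A `<=` X -> B `<=` Y ->
  (forall x y, X x -> B y -> inner x y != 0 -> A x) -> finite_set A ->
  finite_set B /\ (#|` fset_set B| <= #|` fset_set A|)%N.
Proof.
move=> AX BY AB Afin.
have key (t : {fset H}) : [set` t] `<=` B -> (#|` t| <= #|` fset_set A|)%N.
  move=> tB; rewrite -(ler_nat R).
  have -> : #|` t|%:R = \sum_(y <- t) \sum_(x <- fset_set A)
      rnorm (inner y x : R[i]^o) ^+ 2 :> R.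
    rewrite big_seq (eq_bigr (fun=> 1)) => [|y /tB By].
      by rewrite -big_seq big_const_seq count_predT iter_addr_0.
    rewrite (parseval X1 (fset_uniq (fset_set A)))//.
    - by rewrite /rnorm Y1.2 ?expr1n//; apply: BY.
    - by move=> x; rewrite in_fset_set// inE; apply: AX.
    - by move=> x Xx xy; rewrite in_fset_set// inE; apply: AB xy.
  rewrite exchange_big/=.
  apply: (@le_trans _ _ (\sum_(x <- fset_set A) 1)).
    rewrite big_seq [leRHS]big_seq; apply: ler_sum => x xA.
    have Xx : X x by move: xA; rewrite in_fset_set// inE; apply: AX.
    have -> : 1 = rnorm x ^+ 2 by rewrite /rnorm X1.2// expr1n.
    apply: le_trans (bessel Y1 (fset_uniq t) _ x); last by move=> y /tB/BY.
    by apply: ler_sum => y _; rewrite innerC rnorm_conj.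
  by rewrite big_const_seq count_predT iter_addr_0.
have Bfin : finite_set B.
  apply: contrapT => /(infinite_set_fset #|` fset_set A|.+1)[t /key].
  by rewrite leqNgt => /negbTE ->.
by split=> //; apply: key => y /=; rewrite in_fset_set// inE.
Qed.

End Blocks.

(** A countable block is finite with a prescribed number of elements, or
    countably infinite. *)
Lemma block_card_eq X Y (A B : set H) :
  orthonormal_basis X -> orthonormal_basis Y -> A `<=` X -> B `<=` Y ->
  (forall x y, X x -> B y -> inner x y != 0 -> A x) ->
  (forall x y, A x -> Y y -> inner x y != 0 -> B y) ->
  countable A -> countable B -> (A #= B)%card.
Proof.
move=> [X1 XT] [Y1 YT] AX BY AB BA Ac Bc.
have neqC x y : inner x y != 0 -> inner y x != 0.
  by apply: contra => /eqP/inner_eq0C ->.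
have BA' y x : Y y -> A x -> inner y x != 0 -> B y.
  by move=> Yy Ax /neqC; apply: BA.
have [Af|Ai] := pselect (finite_set A).
  have [Bf BAle] := finite_block X1 Y1 XT AX BY AB Af.
  have [_ ABle] := finite_block Y1 X1 YT BY AX BA' Bf.
  by apply/fcard_eq => //; apply/eqP; rewrite eqn_leq ABle BAle.
have Bi : infinite_set B.
  by move=> Bf; apply: Ai; have [] := finite_block Y1 X1 YT BY AX BA' Bf.
apply/card_eqPle; split.
  by apply: card_le_trans Ac _; apply/infiniteP.
by apply: card_le_trans Bc _; apply/infiniteP.
Qed.

Section Components.
Context X Y (X1 : orthonormal_set X) (Y1 : orthonormal_set Y).
Context (XT : total_set X).

(** Edges between members of [X] at distance two in the bipartite graph that joins
    [x] in [X] to [y] in [Y] when [<x, y>] is not 0. *)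
Definition linked : rel H := fun x x' =>
  `[< [/\ X x, X x' & exists2 y, Y y & inner x y != 0 /\ inner x' y != 0] >].

Definition component x : set H :=
  [set x' | exists2 s, path linked x s & last x s = x'].

Lemma component_refl x : component x x.
Proof. by exists [::]. Qed.

Lemma component_trans x y z : component x y -> component y z -> component x z.
Proof.
move=> [s ps <-] [t pt <-]; exists (s ++ t); last by rewrite last_cat.
by rewrite cat_path ps.
Qed.

Lemma linked_component x y : linked x y -> component x y.
Proof. by move=> xy; exists [:: y] => //=; rewrite xy. Qed.

Lemma countable_linked x : countable [set x' | linked x x'].
Proof.
apply: sub_countable (bigcup_countable (countable_neighbours x Y1)
  (fun y _ => countable_neighbours y X1)).
apply: subset_card_le => x' /asboolP[_ Xx' [y Yy [xy x'y]]].
exists y; split=> //; apply/eqP => yx'; move/eqP: x'y; apply.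
exact: inner_eq0C.
Qed.

Lemma countable_component x : countable (component x).
Proof.
pose P n x := [set x' | exists2 s, path linked x s & size s = n /\ last x s = x'].
have Pc n z : countable (P n z).
  elim: n z => [|n IH] z.
    apply: sub_countable (countable1 z); apply: subset_card_le => _ [s _ [+ <-]].
    by move=> /size0nil ->.
  apply: sub_countable (bigcup_countable (countable_linked z) (fun y _ => IH y)).
  apply: subset_card_le => x' [[|y s] /= ps [sn sl]] //.
  by move: ps sn => /andP[zy ps] [sn]; exists y => //; exists s.
apply: sub_countable (bigcup_countable (countableP [set: nat]) (fun n _ => Pc n x)).
apply: subset_card_le => x' [s ps sx'].
by exists (size s) => //; exists s.
Qed.

(** The component of [y], recorded as a set of members of [X] so that it can be
    compared with [component]. *)
Definition component_of y : set H :=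
  [set x' | exists2 x, X x & inner x y != 0 /\ component x x'].

Lemma component_ofE x y : X x -> Y y -> inner x y != 0 ->
  component_of y = component x.
Proof.
move=> Xx Yy xy; apply/seteqP; split=> z; last by exists x.
move=> [x' Xx' [x'y]]; apply: component_trans; apply: linked_component.
by apply/asboolP; split=> //; exists y.
Qed.

Lemma countable_X_block r : countable [set x | X x /\ component x = r].
Proof.
have [[x [Xx <-]]|nX] := pselect (exists x, X x /\ component x = r).
  apply: sub_countable (countable_component x); apply: subset_card_le.
  by move=> x' [_ <-]; apply: component_refl.
apply: sub_countable (countable0 H); apply: subset_card_le => x Hx.
by apply: nX; exists x.
Qed.

Lemma exists_neighbour y : y <> 0 -> exists x, X x /\ inner x y != 0.
Proof.
move=> y0; apply: contrapT => ny; apply: y0.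
suff : [set y | forall x, X x -> inner x y = 0] y by rewrite XT.
by move=> x Xx; apply/eqP; apply: contra_notT ny => xy; exists x.
Qed.

Lemma countable_Y_block r : countable [set y | Y y /\ component_of y = r].
Proof.
apply: sub_countable (bigcup_countable (countable_X_block r)
  (fun x _ => countable_neighbours x Y1)).
apply: subset_card_le => y [Yy yr].
have [x [Xx xy]] := exists_neighbour (Y1.1.1 _ Yy).
by exists x; split=> //; rewrite -yr (component_ofE Xx Yy xy).
Qed.

End Components.

(** The components of the bipartite graph are countable since vertices have
    countably many neighbours, and each of them meets [X] and [Y] in sets of the
    same cardinality.  Bijections chosen on the components glue together, which
    avoids cardinal arithmetic. *)
Lemma orthonormal_bases_equipotent X Y :
  orthonormal_basis X -> orthonormal_basis Y -> exists f, set_bij X Y f.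
Proof.
move=> XB YB; have [[X1 XT] [Y1 YT]] := (XB, YB).
pose A r := [set x | X x /\ component X Y x = r].
pose B r := [set y | Y y /\ component_of X Y y = r].
have /choice[f fP] r : exists f, set_bij (A r) (B r) f.
  apply/card_set_bijP; apply: block_card_eq XB YB _ _ _ _ _ _.
  - by move=> x [].
  - by move=> y [].
  - by move=> x y Xx [Yy yr] xy; split=> //; rewrite -yr (component_ofE Xx Yy xy).
  - by move=> x y [Xx xr] Yy xy; split=> //; rewrite (component_ofE Xx Yy xy).
  - exact: countable_X_block.
  - exact: countable_Y_block.
exists (fun x => f (component X Y x) x); split.
- move=> x Xx; have [fun_f _ _] := fP (component X Y x).
  by have [] : B (component X Y x) (f (component X Y x) x) by apply: fun_f.
- move=> x x'; rewrite !inE => Xx Xx' E.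
  have [fun_f inj_f _] := fP (component X Y x).
  have [fun_f' _ _] := fP (component X Y x').
  have [_ q] : B (component X Y x) (f (component X Y x) x) by apply: fun_f.
  have [_ q'] : B (component X Y x') (f (component X Y x') x') by apply: fun_f'.
  have xx' : component X Y x = component X Y x' by rewrite -q E q'.
  by apply: inj_f; rewrite ?inE//= E xx'.
- move=> y Yy; have [_ _ surj_f] := fP (component_of X Y y).
  have [x [Xx xy] <-] : [set f (component_of X Y y) x | x in A (component_of X Y y)] y.
    by apply: surj_f.
  by exists x => //=; rewrite xy.
Qed.

End OrthonormalBases.

(** * The correspondence *)

Section Correspondence.
Context {R : realType} {H : hilbertType R} {HH : hilbertTensor H H}.
Context (HHl : hilbertTensor HH H) (HHr : hilbertTensor H HH).
Local Notation mul := Defs.mul.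

Lemma unitary_of_bases (X Y : set H) (f : H -> H) :
  orthonormal_basis X -> orthonormal_basis Y -> set_bij X Y f ->
  exists u : H -> H, [/\ unitary u, forall x, X x -> u x = f x &
    forall x y, inner (u x) (u y) = inner x y].
Proof.
move=> [X1 XT] [Y1 YT] [fun_f inj_f surj_f].
pose v (x : {x | X x}) := sval x; pose w (x : {x | X x}) := f (sval x).
have total_sig (Z : set H) z : total_set Z -> (forall x, Z x -> inner x z = 0) -> z = 0.
  move=> ZT zZ; suff : [set y | forall x, Z x -> inner x y = 0] z by rewrite ZT.
  exact: zZ.
have vT : total_family v.
  by move=> z zX; apply: (total_sig _ _ XT) => x Xx; apply: (zX (exist _ x Xx)).
have wT : total_family w.
  move=> z zX; apply: (total_sig _ _ YT) => y /surj_f[x Xx <-].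
  exact: (zX (exist _ x Xx)).
have vw i j : inner (w i) (w j) = inner (v i) (v j).
  case: i j => [x Xx] [y Xy]; rewrite /v /w /=.
  rewrite (orthonormal_inner Y1 (fun_f _ Xx) (fun_f _ Xy)) (orthonormal_inner X1 Xx Xy).
  by congr (nat_of_bool _)%:R; apply/eqP/eqP => [|-> //]; apply: inj_f; rewrite inE.
have [h [hB hE hin]] := isometric_extension vT vw.
have [k [kB kE kin]] := isometric_extension wT (fun i j => esym (vw i j)).
have hk : h \o k = id.
  apply: (eq_on_total wT) => [||i /=]; last by rewrite kE hE.
    exact: bounded_linear_comp.
  exact: bounded_linear_id.
have ah : adjoint h = k.
  apply: adjoint_unique => x y.
  by rewrite -{1}[y]/(id y) -hk /= hin.
exists h; split=> //; last by move=> x Xx; apply: (hE (exist _ x Xx)).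
split=> //; rewrite ah //; apply/funext => x /=; apply: inner_injl => y.
by rewrite -[LHS]hin -[h (k (h x))]/((h \o k) (h x)) hk hin.
Qed.

Lemma special_unitarily_isomorphic (mu mu' : HH -> H) :
  frobenius HHl HHr mu -> special mu -> frobenius HHl HHr mu' -> special mu' ->
  unitarily_isomorphic mu mu'.
Proof.
move=> muF sp muF' sp'.
have GB := (specialP muF).1 sp; have GB' := (specialP muF').1 sp'.
have [f fbij] := orthonormal_bases_equipotent GB GB'.
have [u [uU uf uin]] := unitary_of_bases GB GB' fbij.
exists u; split=> // x y; apply/eqP; rewrite -subr_eq0; apply/eqP.
suff : [set z | forall g, group_like mu' g -> inner g z = 0]
    (u (mul mu x y) - mul mu' (u x) (u y)) by rewrite GB'.2.
move=> g' Gg'; have [_ _ surj_f] := fbij; have [g Gg gE] := surj_f _ Gg'.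
apply: inner_eq0C; rewrite innerBl.
have [_ ->] := group_like_character muF' Gg'.
rewrite -gE -(uf _ Gg) !uin; have [_ ->] := group_like_character muF Gg.
by rewrite subrr.
Qed.

(** Every correspondence of the theorem is the restriction of the bijection
    between all structures and all bounded orthogonal sets to a property of
    [mu] that can be read off on [group_like mu]. *)
Lemma group_like_bij (P : set (HH -> H)) (Q : set (set H)) :
  (forall X, Q X -> orthogonal_set X /\ bounded_above X) ->
  (forall mu, frobenius HHl HHr mu -> P mu <-> Q (group_like mu)) ->
  set_bij [set mu : HH -> H | frobenius HHl HHr mu /\ P mu] Q group_like.
Proof.
move=> QX PQ; split.
- by move=> mu [muF Pmu]; apply/PQ.
- by move=> mu mu'; rewrite !inE => -[muF _] [muF' _]; apply: (group_like_inj muF muF').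
- move=> X XQ; have [Xo Xb] := QX X XQ.
  have [mu muF muX] := frobenius_exists HHl HHr Xo Xb.
  by exists mu => //; split=> //; apply/(PQ mu muF); rewrite muX.
Qed.

Lemma orthonormal_bounded_above (X : set H) : orthonormal_set X -> bounded_above X.
Proof.
by move=> [_ X1]; exists 1; split=> // x Xx; rewrite X1.
Qed.

End Correspondence.

Theorem theorem37 (R : realType) (H : hilbertType R)
    (HH : hilbertTensor H H)
    (HHl : hilbertTensor HH H) (HHr : hilbertTensor H HH) :
  [/\ set_bij [set mu : HH -> H | frobenius HHl HHr mu /\ mu <> cst 0]
        [set X | [/\ orthogonal_set X, bounded_above X & X !=set0]]
        group_like,
      set_bij [set mu : HH -> H | frobenius HHl HHr mu /\ semisimple mu]
        [set X | orthogonal_basis X /\ bounded_above X]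
        group_like,
      set_bij [set mu : HH -> H | [/\ frobenius HHl HHr mu,
            partial_isometry (adjoint mu) & adjoint mu <> cst 0]]
        [set X | orthonormal_set X /\ X !=set0]
        group_like,
      set_bij [set mu : HH -> H | frobenius HHl HHr mu /\ special mu]
        [set X | orthonormal_basis X]
        group_like /\
      (forall mu mu' : HH -> H,
         frobenius HHl HHr mu -> special mu ->
         frobenius HHl HHr mu' -> special mu' ->
         unitarily_isomorphic mu mu') &
      exists mu0 : HH -> H,
        [set mu : HH -> H | frobenius HHl HHr mu /\ radical mu] = [set mu0] /\
        [set mu : HH -> H | frobenius HHl HHr mu /\ group_like mu = set0] =
          [set mu0]].
Proof.
have nonempty (X : set H) : X <> set0 <-> X !=set0.
  by split=> [/eqP/set0P//|/set0P/eqP].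
have Go := @group_like_orthogonal R H HH HHl HHr.
have Gb := @group_like_bounded R H HH HHl HHr.
split.
- apply: group_like_bij => [X []//|mu muF].
  rewrite (mul_eq0P muF) nonempty; split=> [G0|[]//].
  by split=> //; [exact: Go muF|exact: Gb muF].
- apply: group_like_bij => [X [[]]//|mu muF].
  rewrite (semisimpleP muF); split=> [GT|[[]]//].
  by split; [split=> //; exact: Go muF|exact: Gb muF].
- have -> : [set mu : HH -> H | [/\ frobenius HHl HHr mu,
      partial_isometry (adjoint mu) & adjoint mu <> cst 0]] =
    [set mu : HH -> H | frobenius HHl HHr mu /\
      (partial_isometry (adjoint mu) /\ adjoint mu <> cst 0)].
    by apply/seteqP; split=> mu; [move=> [? ? ?]; split | move=> [? [? ?]]; split].
  apply: (group_like_bij (P := fun mu => _ /\ _)) => [X [X1 _]|mu muF].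
    by split; [case: X1|apply: orthonormal_bounded_above].
  by rewrite (partial_isometryP muF) (comul_eq0P muF) nonempty.
- split; last exact: special_unitarily_isomorphic.
  apply: group_like_bij => [X [X1 _]|mu muF]; last exact: (specialP muF).
  by split; [case: X1|apply: orthonormal_bounded_above].
have o0 : orthogonal_set (@set0 H) by [].
have b0 : bounded_above (@set0 H) by exists 1.
have [mu0 mu0F mu00] := frobenius_exists HHl HHr o0 b0.
have E : [set mu : HH -> H | frobenius HHl HHr mu /\ group_like mu = set0] =
    [set mu0].
  apply/seteqP; split=> [mu [muF mu_0]|_ ->//].
  by apply: (group_like_inj muF mu0F); rewrite mu_0 mu00.
exists mu0; split=> //; rewrite -E.
by apply/seteqP; split=> mu [muF /(radicalP muF) mu_0].
Qed.
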